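(* Let $\gamma>-1$ and fix an integer $n\ge0$. (i) Let $\sum_{j=1}^N\lambda_jf(\xi_j)$ be a positive cubature formula on $(V,\nu_\gamma)$ exact on $\Pi_{2n}(V)$. Choose one preimage $z_j\in\mathbb{B}^2$ with $Q(z_j)=\xi_j$ for every non-apex node. Replace each such node by the pair $\pm z_j$, each with weight $\lambda_j/2$; if the apex occurs as a node, retain the origin of $\mathbb{B}^2$ as a node with the apex's original weight. The resulting disk formula is positive, centrally symmetric, and exact on $\Pi_{4n+1}(\mathbb{B}^2)$ for $\mu_\gamma$. (ii) Pushing any positive disk cubature formula on $(\mathbb{B}^2,\mu_\gamma)$ exact on $\Pi_{4n}(\mathbb{B}^2)$ through $Q$ (each node $z$ of weight $w$ becomes the node $Q(z)$ of weight $w$), and merging nodes with the same image by adding their weights, gives a positive cubature formula on $(V,\nu_\gamma)$ exact on $\Pi_{2n}(V)$. (iii) Restricted to centrally symmetric positive disk rules exact on $\Pi_{4n+1}(\mathbb{B}^2)$, the two constructions are inverse to each other; hence the lifting in (i) is a bijection from positive cubature rules on $(V,\nu_\gamma)$ exact on $\Pi_{2n}(V)$ onto centrally symmetric positive cubature rules on $(\mathbb{B}^2,\mu_\gamma)$ exact on $\Pi_{4n+1}(\mathbb{B}^2)$.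
   Context: $V=\{(x,y,t)\in\mathbb{R}^3:x^2+y^2=t^2,\ 0\le t\le1\}$, parametrized by $(x,y,t)=(t\cos\phi,t\sin\phi,t)$, with the probability measure $d\nu_\gamma(t,\phi)=\frac{\gamma+1}{2\pi}(1-t)^\gamma\,dt\,d\phi$ on $0\le t\le1$, $0\le\phi<2\pi$. The apex is the origin of $\mathbb{R}^3$. $\mathbb{B}^2=\{(u,v)\in\mathbb{R}^2:u^2+v^2\le1\}$ carries the probability measure $d\mu_\gamma(u,v)=\frac{\gamma+1}{\pi}(1-u^2-v^2)^\gamma\,du\,dv$. The map $Q:\mathbb{B}^2\to V$ is $Q(u,v)=(u^2-v^2,\,2uv,\,u^2+v^2)$. $\Pi_m(V)$ (resp. $\Pi_m(\mathbb{B}^2)$) is the space of restrictions to $V$ (resp. $\mathbb{B}^2$) of polynomials in three (resp. two) real variables of total degree at most $m$. A positive cubature rule (formula) on $V$ (resp. $\mathbb{B}^2$) is a finite set of distinct nodes in $V$ (resp. $\mathbb{B}^2$) with strictly positive weights; it is exact on a space of functions if its weighted sum equals the integral against $\nu_\gamma$ (resp. $\mu_\gamma$) for every function in the space. A disk rule is centrally symmetric if every nonzero node $z$ occurs together with $-z$ with the same weight. *)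

(* Defs.v *)
From HB Require Import structures.
From mathcomp Require Import all_boot all_order all_algebra.
From mathcomp Require Import finmap.
(* mpoly comes first and without its notations: these clash with those of
   mathcomp-analysis, and so does its [isMeasure]. *)
From mathcomp Require Import -(notations) mpoly.
From mathcomp Require Import all_classical all_reals all_analysis.
From mathcomp Require Import measurable_realfun.

Set Implicit Arguments.
Unset Strict Implicit.
Unset Printing Implicit Defensive.

Import Order.TTheory GRing.Theory Num.Theory.
Import numFieldNormedType.Exports.

Local Open Scope classical_set_scope.
Local Open Scope ring_scope.

Definition cone (R : realType) : set (R * R * R) :=
  [set p | p.1.1 ^+ 2 + p.1.2 ^+ 2 = p.2 ^+ 2 /\ 0 <= p.2 <= 1].

Definition disk (R : realType) : set (R * R) :=
  [set z | z.1 ^+ 2 + z.2 ^+ 2 <= 1].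

Definition Qmap (R : realType) (z : R * R) : R * R * R :=
  (z.1 ^+ 2 - z.2 ^+ 2, 2 * z.1 * z.2, z.1 ^+ 2 + z.2 ^+ 2).

(* [msize p] is the total degree of p plus one (and 0 for p = 0).  A function
   on D is represented by a total function whose values off D are irrelevant. *)
Definition Pi_on (R : realType) (k : nat) (T : Type) (coord : T -> 'I_k -> R)
    (D : set T) (m : nat) : set (T -> R) :=
  [set f | exists2 p : mpoly k R, (msize p <= m.+1)%N &
           forall x, D x -> f x = meval (coord x) p].

Definition coord2 (R : realType) (z : R * R) : 'I_2 -> R :=
  tnth [tuple z.1; z.2].

Definition coord3 (R : realType) (p : R * R * R) : 'I_3 -> R :=
  tnth [tuple p.1.1; p.1.2; p.2].

Definition Pi_cone (R : realType) (m : nat) : set (R * R * R -> R) :=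
  Pi_on (@coord3 R) (@cone R) m.

Definition Pi_disk (R : realType) (m : nat) : set (R * R -> R) :=
  Pi_on (@coord2 R) (@disk R) m.

Section density_measure.
Context d (T : measurableType d) (R : realType).
Variables (mu : {measure set T -> \bar R}) (D : set T) (f : T -> R).

Definition density_measure (A : set T) : \bar R :=
  (\int[mu]_(x in D `&` A) (f x)%:E)%E.

Hypotheses (mD : measurable D) (mf : measurable_fun D f).
Hypothesis f0 : forall x, D x -> 0 <= f x.

Lemma density_measure0 : density_measure set0 = 0%E.
Proof. by rewrite /density_measure setI0 integral_set0. Qed.

Lemma density_measure_ge0 A : (0 <= density_measure A)%E.
Proof. by apply: integral_ge0 => x [Dx _]; rewrite lee_fin f0. Qed.

Lemma density_measure_sigma_additive : semi_sigma_additive density_measure.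
Proof.
move=> F mF tF mUF; rewrite /density_measure; apply: cvg_toP.
  apply: ereal_nondecreasing_is_cvgn => m n mn.
  by apply: lee_sum_nneg_natr => // k _ _; exact: density_measure_ge0.
rewrite setI_bigcupr ge0_integral_bigcup//=.
- by move=> k; exact: measurableI.
- apply/measurable_EFinP; apply: measurable_funS mf => //.
  by move=> x [k _ []].
- by move=> x [k _ [Dx _]]; rewrite lee_fin f0.
- exact: trivIset_setIl.
Qed.

End density_measure.

Section measures.
Context (R : realType) (g : R).
Hypothesis hg : -1 < g.

Local Notation mR := (measurableTypeR R).

Let leb2 : {measure set (mR * mR) -> \bar R} :=
  (@lebesgue_measure R \x @lebesgue_measure R)%E.

Definition mu_density (z : mR * mR) : R :=
  (g + 1) / pi * (1 - z.1 ^+ 2 - z.2 ^+ 2) `^ g.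

(* p = (t, phi) *)
Definition nu_density (p : mR * mR) : R :=
  (g + 1) / (2 * pi) * (1 - p.1) `^ g.

Definition nu_domain : set (mR * mR) := `[0, 1] `*` `[0, 2 * pi[.

Definition cone_param (p : mR * mR) : mR * mR * mR :=
  (p.1 * cos p.2, p.1 * sin p.2, p.1).

Lemma mu_density_ge0 z : 0 <= mu_density z.
Proof.
rewrite mulr_ge0 ?powR_ge0// divr_ge0 ?pi_ge0//.
by rewrite -lerBlDr sub0r ltW.
Qed.

Lemma nu_density_ge0 p : 0 <= nu_density p.
Proof.
rewrite mulr_ge0 ?powR_ge0// divr_ge0 ?mulr_ge0 ?pi_ge0//.
by rewrite -lerBlDr sub0r ltW.
Qed.

Lemma measurable_mu_density : measurable_fun setT mu_density.
Proof.
apply: measurable_funM => //; apply: (measurableT_comp (measurable_powR g)).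
apply: measurable_funB; last exact: measurable_funX.
by apply: measurable_funB => //; exact: measurable_funX.
Qed.

Lemma measurable_nu_density : measurable_fun setT nu_density.
Proof.
apply: measurable_funM => //; apply: (measurableT_comp (measurable_powR g)).
exact: measurable_funB.
Qed.

Lemma measurable_disk : measurable (@disk R : set (mR * mR)).
Proof.
have mN : measurable_fun setT (fun z : mR * mR => z.1 ^+ 2 + z.2 ^+ 2).
  by apply: measurable_funD; apply: measurable_funX.
have := mN measurableT `]-oo, 1]%classic (measurable_itv _).
by rewrite setTI; congr measurable; apply/seteqP; split => z /=;
  rewrite in_itv.
Qed.

Lemma measurable_nu_domain : measurable nu_domain.
Proof. by apply: measurableX; exact: measurable_itv. Qed.

Lemma measurable_cone_param : measurable_fun setT cone_param.
Proof.
have mc : measurable_fun setT (@cos R).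
  by apply: continuous_measurable_fun; exact: continuous_cos.
have ms : measurable_fun setT (@sin R).
  by apply: continuous_measurable_fun; exact: continuous_sin.
apply: measurable_fun_pair => //; apply: measurable_fun_pair.
- by apply: measurable_funM => //; exact: measurableT_comp mc _.
- by apply: measurable_funM => //; exact: measurableT_comp ms _.
Qed.

(* The hypothesis [-1 < g] is an argument because it is what makes these set
   functions measures. *)
Definition disk_measure of -1 < g : set (mR * mR) -> \bar R :=
  density_measure leb2 (@disk R) mu_density.

Let disk_measure0 : disk_measure hg set0 = 0%E.
Proof. exact: density_measure0. Qed.

Let disk_measure_ge0 A : (0 <= disk_measure hg A)%E.
Proof. by apply: density_measure_ge0 => z _; exact: mu_density_ge0. Qed.

Let disk_measure_sigma_additive : semi_sigma_additive (disk_measure hg).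
Proof.
apply: density_measure_sigma_additive; first exact: measurable_disk.
- by apply: measurable_funTS; exact: measurable_mu_density.
- by move=> z _; exact: mu_density_ge0.
Qed.

HB.instance Definition _ := isMeasure.Build _ _ _ (disk_measure hg)
  disk_measure0 disk_measure_ge0 disk_measure_sigma_additive.

Definition param_measure of -1 < g : set (mR * mR) -> \bar R :=
  density_measure leb2 nu_domain nu_density.

Let param_measure0 : param_measure hg set0 = 0%E.
Proof. exact: density_measure0. Qed.

Let param_measure_ge0 A : (0 <= param_measure hg A)%E.
Proof. by apply: density_measure_ge0 => p _; exact: nu_density_ge0. Qed.

Let param_measure_sigma_additive : semi_sigma_additive (param_measure hg).
Proof.
apply: density_measure_sigma_additive; first exact: measurable_nu_domain.
- by apply: measurable_funTS; exact: measurable_nu_density.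
- by move=> p _; exact: nu_density_ge0.
Qed.

HB.instance Definition _ := isMeasure.Build _ _ _ (param_measure hg)
  param_measure0 param_measure_ge0 param_measure_sigma_additive.

Definition cone_measure (h : -1 < g) : set (mR * mR * mR) -> \bar R :=
  pushforward (param_measure h) cone_param.

Let cone_measure0 : cone_measure hg set0 = 0%E.
Proof. by rewrite /cone_measure /pushforward preimage_set0 measure0. Qed.

Let cone_measure_ge0 A : (0 <= cone_measure hg A)%E.
Proof. exact: (param_measure_ge0 (cone_param @^-1` A)). Qed.

Let cone_measure_sigma_additive : semi_sigma_additive (cone_measure hg).
Proof.
have mpre A : measurable A -> measurable (cone_param @^-1` A).
  by move=> mA; rewrite -[X in measurable X]setTI; exact: measurable_cone_param.
move=> F mF tF mUF; rewrite /cone_measure /pushforward preimage_bigcup.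
apply: measure_semi_sigma_additive.
- by move=> n; exact: mpre.
- apply/trivIsetP => /= i j _ _ ij; rewrite -preimage_setI.
  by move/trivIsetP : tF => /(_ _ _ _ _ ij) ->//; rewrite preimage_set0.
- by rewrite -preimage_bigcup; exact: mpre.
Qed.

HB.instance Definition _ := isMeasure.Build _ _ _ (cone_measure hg)
  cone_measure0 cone_measure_ge0 cone_measure_sigma_additive.

End measures.

(* A rule is a finite map from nodes to weights; two rules are equal iff they
   have the same nodes with the same weights. *)
Definition rule (R : realType) (T : choiceType) := {fmap T -> R}.

Definition rule_sum (R : realType) (T : choiceType) (w : rule R T)
    (f : T -> R) : R := \sum_(x : domf w) w x * f (val x).

Definition positive_cubature (R : realType) (T : choiceType) (D : set T)
    (I : (T -> R) -> \bar R) (F : set (T -> R)) : set (rule R T) :=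
  [set w | [/\ forall x, x \in domf w -> D x,
               forall x : domf w, 0 < w x &
               forall f, F f -> (rule_sum w f)%:E = I f]].

Definition centrally_symmetric (R : realType) (w : rule R (R * R)%type) : Prop :=
  forall z, z \in domf w -> z != 0 -> w.[? - z]%fmap = w.[? z]%fmap.

Definition cone_integral (R : realType) (g : R) (hg : -1 < g)
    (f : R * R * R -> R) : \bar R :=
  (\int[cone_measure hg]_(p in @cone R) (f p)%:E)%E.

Definition disk_integral (R : realType) (g : R) (hg : -1 < g)
    (f : R * R -> R) : \bar R :=
  (\int[disk_measure hg]_(z in @disk R) (f z)%:E)%E.

Definition cone_rules (R : realType) (g : R) (hg : -1 < g) (m : nat) :=
  positive_cubature (@cone R) (cone_integral hg) (@Pi_cone R m).

Definition disk_rules (R : realType) (g : R) (hg : -1 < g) (m : nat) :=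
  positive_cubature (@disk R) (disk_integral hg) (@Pi_disk R m).

Definition symmetric_disk_rules (R : realType) (g : R) (hg : -1 < g) (m : nat) :=
  disk_rules hg m `&` @centrally_symmetric R.

Definition rule_terms (R : realType) (T : choiceType) (w : rule R T) :
  seq (T * R) := [seq (val x, w x) | x : domf w].

(* The rule with the nodes of a list of weighted nodes, where equal nodes are
   merged by adding their weights. *)
Definition merge_terms (R : realType) (T : choiceType) (s : seq (T * R)) :
    rule R T :=
  [fmap x : seq_fset tt (unzip1 s) => \sum_(p <- s | p.1 == val x) p.2]%fmap.

Definition push_rule (R : realType) (w : rule R (R * R)%type) :
    rule R (R * R * R)%type :=
  merge_terms [seq (Qmap p.1, p.2) | p <- rule_terms w].

Definition preimage_choice (R : realType) (w : rule R (R * R * R)%type)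
    (z : R * R * R -> R * R) : Prop :=
  forall xi, xi \in domf w -> xi != 0 -> @disk R (z xi) /\ Qmap (z xi) = xi.

Definition lift_terms (R : realType) (z : R * R * R -> R * R)
    (w : rule R (R * R * R)%type) : seq (R * R * R) :=
  flatten [seq (if p.1 == 0 then [:: (0, p.2)]
                else [:: (z p.1, p.2 / 2); (- z p.1, p.2 / 2)])
          | p <- rule_terms w].

Definition lift_rule (R : realType) (z : R * R * R -> R * R)
    (w : rule R (R * R * R)%type) : rule R (R * R)%type :=
  merge_terms (lift_terms z w).

(* Main.v *)
(** In polar coordinates u + iv = r e^(i theta), the map Q is squaring followed by
    z |-> (z, |z|): it is 2-to-1 off the origin, with (t, phi) = (r^2, 2 theta), so
    du dv = r dr dtheta = dt dphi / 4 and Q pushes mu_gamma forward to nu_gamma.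
    Composition with Q sends polynomials of degree m on the cone onto the even
    polynomials of degree at most 2m on the disk, while odd polynomials integrate to 0
    against mu_gamma and against every centrally symmetric rule.  Exactness therefore
    transfers in both directions, and a centrally symmetric rule is determined by its
    image under Q because the fibers of Q are the pairs {z, -z}.

    The polar change of variables is done one variable at a time: slope coordinates
    u = v s on the half plane v > 0, Tonelli, then t = (1 + s^2) v^2, s = tan theta and
    phi = pi - 2 theta. *)

From HB Require Import structures.
Require Import Defs.
From mathcomp Require Import all_boot all_order all_algebra finmap.
From mathcomp Require Import -(notations) mpoly.
From mathcomp Require Import all_classical all_reals all_analysis.
From mathcomp Require Import measurable_realfun.
From mathcomp Require Import ring lra.

Set Implicit Arguments.
Unset Strict Implicit.
Unset Printing Implicit Defensive.

Import Order.TTheory GRing.Theory Num.Theory.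
Import numFieldNormedType.Exports HBNNSimple.
Local Open Scope classical_set_scope.
Local Open Scope ring_scope.

(** * Densities and one-dimensional substitutions *)

(** Simple functions increasing to [G] reduce the claim, by monotone convergence on both sides, to
    indicators of measurable sets, where it is the hypothesis on [nu]. *)
Lemma ge0_integral_density d (T : measurableType d) (R : realType)
    (mu nu : {measure set T -> \bar R}) (f : T -> R) (G : T -> \bar R) :
  measurable_fun setT f -> (forall x, 0 <= f x) ->
  (forall A, measurable A -> nu A = (\int[mu]_(x in A) (f x)%:E)%E) ->
  measurable_fun setT G -> (forall x, 0 <= G x)%E ->
  (\int[nu]_x G x = \int[mu]_x (G x * (f x)%:E))%E.
Proof.
move=> mf f0 nuE mG G0; pose h := nnsfun_approx measurableT mG.
have hcvg x : (h n x)%:E @[n --> \oo] --> G x by exact: cvg_nnsfun_approx.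
have hnd x m n : (m <= n)%N -> h m x <= h n x.
  by move=> mn; exact/lefP/nd_nnsfun_approx.
have mfE : measurable_fun setT (EFin \o f) by exact/measurable_EFinP.
have mhE n : measurable_fun setT (EFin \o h n) by exact/measurable_EFinP.
transitivity (limn (fun n => \int[nu]_x (h n x)%:E))%E.
  rewrite -monotone_convergence//.
  - by apply: eq_integral => x _; apply/esym/cvg_lim.
  - by move=> n x _; rewrite lee_fin.
  - by move=> x _ m n mn; rewrite lee_fin hnd.
transitivity (limn (fun n => \int[mu]_x ((h n x)%:E * (f x)%:E)))%E; last first.
  rewrite -monotone_convergence//.
  - apply: eq_integral => x _; apply/cvg_lim => //.
    by apply: cvgeZr => //.
  - by move=> n; apply: (emeasurable_funM (mhE n) mfE).
  - by move=> n x _; rewrite mule_ge0 ?lee_fin.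
  - by move=> x _ m n mn; rewrite lee_wpmul2r ?lee_fin ?hnd.
(* Both integrals of the simple function are expanded over its finitely many values and compared
   level set by level set. *)
congr (limn _); apply/funext => n.
have hE x : (h n x)%:E =
    (\sum_(r \in range (h n)) (r * \1_(h n @^-1` [set r]) x)%:E)%E.
  by rewrite fimfunE fsumEFin.
under eq_integral do rewrite hE.
rewrite ge0_integral_fsum//; first last.
- by move=> r x _; rewrite EFinM nnfun_muleindic_ge0.
- by move=> r; apply/measurable_EFinP; exact: measurable_funM.
under [RHS]eq_integral => x _.
  rewrite hE ge0_mule_fsuml; last by move=> r; exact: nnfun_muleindic_ge0.
  over.
rewrite [RHS]ge0_integral_fsum//; first last.
- move=> r x _; apply: mule_ge0; last by rewrite lee_fin.
  exact: nnfun_muleindic_ge0.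
- move=> r; apply: emeasurable_funM => //.
  by apply/measurable_EFinP; exact: measurable_funM.
apply: eq_fsbigr => r; rewrite inE => -[t _ <-].
rewrite integralZl_indic_nnsfun// integral_indic// setIT nuE//.
under [RHS]eq_integral do rewrite EFinM -muleA.
rewrite ge0_integralZl//; first last.
- by rewrite lee_fin.
- by move=> x _; rewrite mule_ge0 ?lee_fin.
- by apply: emeasurable_funM => //; apply/measurable_EFinP.
congr (_ * _)%E; rewrite integral_mkcond; apply: eq_integral => x _.
by rewrite epatch_indic/= muleC.
Qed.

(** Bundled as a measure, so that pushforwards and uniqueness of measures apply to an arbitrary
    density. *)
Definition measure_with_density d (T : measurableType d) (R : realType)
    (mu : {measure set T -> \bar R}) (D : set T) (f : T -> R)
    (mD : measurable D) (mf : measurable_fun D f)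
    (f0 : forall x, D x -> 0 <= f x) : {measure set T -> \bar R} :=
  HB.pack (density_measure mu D f)
    (isMeasure.Build _ _ _ (density_measure mu D f)
      (density_measure0 mu D f) (density_measure_ge0 mu f0)
      (@density_measure_sigma_additive _ _ _ mu _ _ mD mf f0)).

Lemma ge0_integral_density_on d (T : measurableType d) (R : realType)
    (mu nu : {measure set T -> \bar R}) (D : set T) (f : T -> R)
    (G : T -> \bar R) :
  measurable D -> measurable_fun setT f -> (forall x, D x -> 0 <= f x) ->
  (forall A, measurable A -> nu A = density_measure mu D f A) ->
  measurable_fun setT G -> (forall x, 0 <= G x)%E ->
  (\int[nu]_x G x = \int[mu]_(x in D) (G x * (f x)%:E))%E.
Proof.
move=> mD mf f0 nuE mG G0.
rewrite (@ge0_integral_density _ _ _ mu nu (f \_ D))//.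
- rewrite [RHS]integral_mkcond; apply: eq_integral => x _.
  by rewrite !patchE; case: ifP => // _; rewrite mule0.
- by apply/(measurable_restrict _ _ measurableT)=> //; rewrite setTI; exact: measurable_funTS.
- by move=> x; rewrite patchE; case: ifPn => // /set_mem /f0.
- move=> A mA; rewrite nuE// /density_measure setIC integral_mkcondr.
  by apply: eq_integral => x _; rewrite !patchE; case: ifP.
Qed.

(* The hypothesis says that [phi] pushes the measure of density [f] on [D] forward to
   Lebesgue measure on [E]; it is only needed on half-open intervals. *)
Lemma ge0_integral_substitution (R : realType) (D E : set (measurableTypeR R))
    (phi : measurableTypeR R -> measurableTypeR R) (f : measurableTypeR R -> R)
    (G : measurableTypeR R -> \bar R) :
  measurable D -> measurable E ->
  measurable_fun setT phi -> measurable_fun setT f ->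
  (forall x, D x -> 0 <= f x) ->
  (forall a b : R, (a < b)%R ->
    \int[lebesgue_measure]_(x in D `&` phi @^-1` `]a, b]%classic) (f x)%:E =
    lebesgue_measure (E `&` `]a, b]%classic))%E ->
  measurable_fun setT G -> (forall x, 0 <= G x)%E ->
  (\int[lebesgue_measure]_(y in E) G y =
   \int[lebesgue_measure]_(x in D) (G (phi x) * (f x)%:E))%E.
Proof.
move=> mD mE mphi mf f0 fE mG G0.
pose leb : {measure set (measurableTypeR R) -> \bar R} := @lebesgue_measure R.
(* [m1] is Lebesgue measure on [E] and [m2] has density [f] on [D]; the claim amounts to [m1] being
   the image of [m2] under [phi]. *)
pose m1 := @measure_with_density _ _ _ leb E (cst 1) mE
  (measurable_cst _) (fun _ _ => ler01).
pose m2 := @measure_with_density _ _ _ leb D f mD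
  (measurable_funTS mf) f0.
have m1E A : measurable A -> m1 A = leb (E `&` A).
  by move=> mA; rewrite /m1/= /density_measure (integral_cst _ _ 1%E) ?mul1e//; exact: measurableI.
pose mphi_mixin := isMeasurableFun.Build _ _ _ _ _ mphi.
pose phi' : {mfun (measurableTypeR R) >-> (measurableTypeR R)} :=
  HB.pack phi mphi_mixin.
transitivity (\int[m1]_x G x)%E.
  rewrite (@ge0_integral_density_on _ _ _ leb m1 E (cst 1))//.
  by apply: eq_integral => x _; rewrite mule1.
transitivity (\int[pushforward m2 phi']_x G x)%E; last first.
  rewrite ge0_integral_pushforward//= preimage_setT.
  rewrite (@ge0_integral_density_on _ _ _ leb m2 D f)//.
  exact: measurableT_comp.
apply: eq_measure_integral => A mA _.
rewrite -[RHS]/((pushforward m2 phi' : {measure set _ -> \bar R}) A).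
(* Half-open intervals are stable under intersection and generate the Borel sets, and the intervals
   ]-n, n] exhaust the line with finite [m1]-mass, so agreement on half-open intervals is enough. *)
apply: (@measure_unique _ R (measurableTypeR R) (@ocitv R)
  (fun n => `](- n%:R)%R, n%:R]%classic) _ _ _ _ m1 (pushforward m2 phi')) => //.
- exact: ocitvI.
- by move=> n; exact: is_ocitv.
- apply/seteqP; split => // x _.
  exists (Num.truncn `|x|).+1 => //=.
  rewrite in_itv/=.
  have : `|x| < (Num.truncn `|x|).+1%:R by exact: truncnS_gt.
  by rewrite ltr_norml => /andP[-> /ltW].
- move=> B /ocitvP[->|[[a b]/= ab ->]]; first by rewrite !measure0.
  by apply: (etrans (m1E _ _)) => //; apply/esym/fE.
- move=> n; have -> : m1 `](- n%:R)%R, n%:R]%classic =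
      leb (E `&` `](- n%:R)%R, n%:R]%classic) by apply: m1E.
  have lt_oo : (leb `](- n%:R)%R, n%:R]%classic < +oo)%E.
    rewrite -[leb _]/(@lebesgue_measure R _) lebesgue_measure_itv/=.
    by case: ifP => _; rewrite ltry.
  by apply: (le_lt_trans _ lt_oo); apply: le_measure; rewrite ?inE//; exact: measurableI.
Qed.

Lemma ge0_integral_affine (R : realType) (p q : R)
    (G : measurableTypeR R -> \bar R) :
  p != 0 -> measurable_fun setT G -> (forall x, 0 <= G x)%E ->
  (\int[lebesgue_measure]_y G y =
   \int[lebesgue_measure]_x (G (p * x + q)%R * `|p|%:E))%E.
Proof.
move=> p0 mG G0.
apply: (@ge0_integral_substitution R setT setT (fun x => p * x + q) (cst `|p|)) => //.
  by apply: measurable_funD => //; exact: measurable_funM.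
move=> a b ab; rewrite !setTI (integral_cst _ _ `|p|%:E); last first.
  rewrite -[X in measurable X]setTI.
  have : measurable_fun setT (fun x : measurableTypeR R => p * x + q).
    by apply: measurable_funD => //; exact: measurable_funM.
  by apply => //; exact: measurable_itv.
have [p_gt0|p_lt0|pE] := ltgtP 0 p; last by rewrite -pE eqxx in p0.
- rewrite (_ : _ @^-1` _ = `]((a - q) / p), ((b - q) / p)]%classic); last first.
    apply/seteqP; split => x /=; rewrite !in_itv/= ltr_pdivrMr// ler_pdivlMr//;
    by rewrite ltrBlDr lerBrDr (mulrC x).
  rewrite [X in (_ * X)%E]lebesgue_measure_itv/= [RHS]lebesgue_measure_itv/= !lte_fin ab.
  rewrite ltr_pM2r ?invr_gt0// ltrD2r ab -EFinB -EFinM gtr0_norm//.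
  by congr EFin; field.
(* A negative slope reverses the order, so the preimage is closed on the left and open on the
   right. *)
- rewrite (_ : _ @^-1` _ = `[((b - q) / p), ((a - q) / p)[%classic); last first.
    apply/seteqP; split => x /=; rewrite !in_itv/= ltr_ndivlMr// ler_ndivrMr//;
    by rewrite ltrBlDr lerBrDr (mulrC x) andbC.
  rewrite [X in (_ * X)%E]lebesgue_measure_itv/= [RHS]lebesgue_measure_itv/= !lte_fin ab.
  rewrite ltr_nM2r ?invr_lt0// ltrD2r ab -EFinB -EFinM ltr0_norm//.
  by congr EFin; field.
Qed.

Lemma ge0_integral_sqr (R : realType) (c : R)
    (G : measurableTypeR R -> \bar R) :
  0 < c -> measurable_fun setT G -> (forall x, 0 <= G x)%E ->
  (\int[lebesgue_measure]_(y in `]0%R, +oo[) G y =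
   \int[lebesgue_measure]_(x in `]0%R, +oo[)
     (G (c * x ^+ 2)%R * (2 * c * x)%:E))%E.
Proof.
move=> c0 mG G0.
apply: (@ge0_integral_substitution R _ _ (fun x => c * x ^+ 2)
  (fun x => 2 * c * x)) => //.
- by apply: measurable_funM => //; exact: measurable_funX.
- exact: measurable_funM.
- by move=> x /=; rewrite in_itv/= andbT => x0; rewrite !mulr_ge0// ltW.
move=> a b ab.
have [b0|b0] := leP b 0.
  rewrite [X in (\int[_]_(x in X) _)%E](_ : _ = set0); last first.
    apply/seteqP; split => // x /=; rewrite !in_itv/= andbT => -[x0 /andP[_ xb]].
    have : 0 < c * x ^+ 2 by rewrite mulr_gt0// exprn_gt0.
    by rewrite ltNge (le_trans xb b0).
  rewrite integral_set0 [X in lebesgue_measure X](_ : _ = set0) ?measure0//.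
  apply/seteqP; split => // x /=; rewrite !in_itv/= andbT => -[x0 /andP[_ xb]].
  by move: x0; rewrite ltNge (le_trans xb b0).
(* Only the part of ]a, b] on the positive axis is reached: it is ]m, b], and [al], [be] are the
   square-root preimages of its ends. *)
pose m := Num.max a 0.
have m0 : 0 <= m by rewrite le_max lexx orbT.
have mb : m < b by rewrite gt_max ab b0.
pose al := Num.sqrt (m / c); pose be := Num.sqrt (b / c).
have al0 : 0 <= al by rewrite sqrtr_ge0.
have be0 : 0 <= be by rewrite sqrtr_ge0.
have alE : c * al ^+ 2 = m by rewrite sqr_sqrtr ?divr_ge0 ?(ltW c0)// mulrC divfK// gt_eqF.
have beE : c * be ^+ 2 = b by rewrite sqr_sqrtr ?divr_ge0 ?ltW// mulrC divfK// gt_eqF.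
have albe : al < be by rewrite ltr_sqrt ?divr_gt0// ltr_pM2r ?invr_gt0.
rewrite [X in (\int[_]_(x in X) _)%E](_ : _ = `]al, be]%classic); last first.
  apply/seteqP; split => x /=; rewrite !in_itv/= ?andbT.
    move=> [x0]; rewrite -{1}beE ler_pM2l// ler_sqr ?nnegrE ?(ltW x0)//.
    move=> /andP[ax ->]; rewrite andbT -ltr_sqr ?nnegrE ?(ltW x0)//.
    by rewrite -(ltr_pM2l c0) alE gt_max ax mulr_gt0// exprn_gt0.
  move=> /andP[ax xb]; have x0 := le_lt_trans al0 ax; split=> //.
  rewrite -{1}beE ler_pM2l// ler_sqr ?nnegrE ?(ltW x0)// xb andbT.
  apply: (@le_lt_trans _ _ m); first by rewrite le_max lexx.
  by rewrite -alE ltr_pM2l// ltr_sqr ?nnegrE ?(ltW x0).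
rewrite [X in lebesgue_measure X](_ : _ = `]m, b]%classic); last first.
  apply/seteqP; split => x /=; rewrite !in_itv/= ?andbT gt_max.
    by move=> [-> /andP[-> ->]].
  by move=> /andP[/andP[-> ->] ->].
rewrite [RHS]lebesgue_measure_itv/= lte_fin mb.
have cf : continuous (fun x : R => 2 * c * x).
  by move=> x; apply/differentiable_continuous/derivable1_diffP; exact: ex_derive.
have dF (x : R) : is_derive x 1 (fun x : R => c * x ^+ 2) (2 * c * x).
  apply: is_derive_eq; rewrite /GRing.scale/=; ring.
have cF : continuous (fun x : R => c * x ^+ 2).
  by move=> x; apply/differentiable_continuous/derivable1_diffP; apply: ex_derive.
(* Adding the left endpoint changes nothing in the integral and gives a closed interval for the
   fundamental theorem of calculus, with primitive c x^2. *)
rewrite integral_itv_obnd_cbnd; last first.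
  by apply/measurable_EFinP/measurable_funTS; exact: continuous_measurable_fun cf.
rewrite (@continuous_FTC2 _ _ (fun x => c * x ^+ 2))//.
- by rewrite alE beE.
- exact: continuous_subspaceT.
- split.
  + by move=> x _; apply: ex_derive.
  + by apply: cvg_at_right_filter; exact: cF.
  + by apply: cvg_at_left_filter; exact: cF.
- by move=> x _; rewrite derive1E; apply: derive_val.
Qed.

Lemma ge0_integral_tan (R : realType) (G : measurableTypeR R -> \bar R) :
  measurable_fun setT G -> (forall x, 0 <= G x)%E ->
  (\int[lebesgue_measure]_y G y =
   \int[lebesgue_measure]_(x in `](- (pi / 2))%R, (pi / 2)%R[)
     (G (tan x) * (1 + tan x ^+ 2)%:E))%E.
Proof.
move=> mG G0.
pose D : set (measurableTypeR R) := `](- (pi / 2)), (pi / 2)[%classic.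
have cosD x : D x -> cos x != 0.
  by rewrite /D/= in_itv/= => /cos_gt0_pihalf; apply: lt0r_neq0.
have mD : measurable D by exact: measurable_itv.
(* The substitution lemma asks for a map measurable on the whole line; extending by zero off [D]
   reduces this to continuity of tan on the open interval [D]. *)
have mtan : measurable_fun setT (tan \_ D : measurableTypeR R -> R).
  apply/(measurable_restrict _ _ measurableT) => //; rewrite setTI.
  apply: open_continuous_measurable_fun; first exact: interval_open.
  by move=> x /[!inE] /cosD; exact: continuous_tan.
have mf : measurable_fun setT
    (fun x : measurableTypeR R => 1 + (tan \_ D) x ^+ 2).
  by apply: measurable_funD => //; exact: measurable_funX.
rewrite (@ge0_integral_substitution R D setT (tan \_ D)
  (fun x => 1 + (tan \_ D) x ^+ 2))//.
- by apply: eq_integral => x xD; rewrite patchE xD.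
- by move=> x _; rewrite addr_ge0// sqr_ge0.
move=> a b ab; rewrite setTI.
have atan_ab : atan a < atan b by exact: lt_atan.
have sub : `[atan a, atan b]%classic `<=` D.
  move=> x; rewrite /D /= !in_itv/= => /andP[ax xb].
  by rewrite (lt_le_trans (atan_gtNpi2 a))// (le_lt_trans xb)// atan_ltpi2.
(* Strict monotonicity of tan on [D] identifies the preimage of ]a, b]. *)
rewrite [X in (\int[_]_(x in X) _)%E](_ : _ = `]atan a, atan b]%classic); last first.
  have Dab x : D x -> (x \in `]atan a, atan b] = (tan x \in `]a, b]))%R.
    move=> Dx; have Dat y : atan y \in `](- (pi / 2)), (pi / 2)[.
      by rewrite in_itv/= atan_gtNpi2 atan_ltpi2.
    have -> : (x \in `]atan a, atan b]) = (tan (atan a) < tan x <= tan (atan b)).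
      rewrite in_itv/= ltr_tan ?Dat//; congr (_ && _).
      by rewrite leNgt [in RHS]leNgt ltr_tan ?Dat.
    by rewrite !atanK in_itv.
  apply/seteqP; split => x /=.
    by move=> [Dx]; rewrite patchE mem_set// -Dab.
  move=> xab; have Dx : D x.
    by apply: sub; move: xab; rewrite /= !in_itv/= => /andP[/ltW -> ->].
  by split => //; rewrite patchE mem_set// -Dab.
rewrite [RHS]lebesgue_measure_itv/= lte_fin ab.
rewrite integral_itv_obnd_cbnd; last exact/measurable_EFinP/measurable_funTS.
under eq_integral => x /[!inE] /sub Dx do rewrite patchE mem_set//.
have dtan x : D x -> is_derive x 1 tan (1 + tan x ^+ 2).
  by move=> Dx; rewrite -cos2_tan2 ?cosD//; apply: is_derive_tan; exact: cosD.
have ctan x : D x -> {for x, continuous (@tan R)} by move=> /cosD/continuous_tan.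
have Da : D (atan a) by apply: sub; rewrite /= in_itv/= lexx ltW.
have Db : D (atan b) by apply: sub; rewrite /= in_itv/= lexx ltW.
rewrite (@continuous_FTC2 _ _ tan)//.
- by rewrite !atanK.
- apply: continuous_in_subspaceT => x /[!inE] /sub Dx.
  have := dtan x Dx => ?.
  by apply/differentiable_continuous/derivable1_diffP; exact: ex_derive.
- split.
  + move=> x xab; have [] // := dtan x _.
    by apply: sub; apply: subset_itv_oo_cc.
  + by apply: cvg_at_right_filter; exact: ctan.
  + by apply: cvg_at_left_filter; exact: ctan.
- move=> x xab; rewrite derive1E; have [] // := dtan x _.
  by apply: sub; apply: subset_itv_oo_cc.
Qed.

(** * Polar coordinates *)

Section fubini_on.
Context d1 d2 (T1 : measurableType d1) (T2 : measurableType d2) (R : realType).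
Variables (m1 : {sigma_finite_measure set T1 -> \bar R})
  (m2 : {sigma_finite_measure set T2 -> \bar R}).
Variables (A : set T1) (B : set T2) (f : T1 * T2 -> \bar R).
Hypotheses (mA : measurable A) (mB : measurable B).
Hypotheses (mf : measurable_fun setT f).
Hypothesis f0 : forall z, (A `*` B) z -> (0 <= f z)%E.

Let g := f \_ (A `*` B).

Let mg : measurable_fun setT g.
Proof.
apply/(measurable_restrict _ _ measurableT); first exact: measurableX.
by rewrite setTI; exact: measurable_funTS.
Qed.

Let g0 z : (0 <= g z)%E.
Proof. by rewrite /g patchE; case: ifPn => // /set_mem/f0. Qed.

Let gE x y : g (x, y) = if x \in A then ((fun y => f (x, y)) \_ B) y else 0%E.
Proof. by rewrite /g !patchE in_setX/=; case: (x \in A). Qed.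

Let gE' x y : g (x, y) = if y \in B then ((fun x => f (x, y)) \_ A) x else 0%E.
Proof. by rewrite /g !patchE in_setX/=; case: (x \in A); case: (y \in B). Qed.

Let int_gl x : (\int[m2]_y g (x, y) =
  ((fun x => \int[m2]_(y in B) f (x, y)) \_ A) x)%E.
Proof.
under eq_integral do rewrite gE.
rewrite patchE; case: ifP => _; last exact: integral0.
by rewrite -integral_mkcond.
Qed.

Let int_gr y : (\int[m1]_x g (x, y) =
  ((fun y => \int[m1]_(x in A) f (x, y)) \_ B) y)%E.
Proof.
under eq_integral do rewrite gE'.
rewrite patchE; case: ifP => _; last exact: integral0.
by rewrite -integral_mkcond.
Qed.

(** Tonelli for [g], the extension of [f] by zero off the rectangle; this is why nonnegativity on
    the rectangle suffices. *)
Lemma ge0_integral_setX_l : (\int[m1 \x m2]_(z in A `*` B) f z =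
  \int[m1]_(x in A) \int[m2]_(y in B) f (x, y))%E.
Proof.
rewrite integral_mkcond -/g fubini_tonelli1// [RHS]integral_mkcond.
by apply: eq_integral => x _; exact: int_gl.
Qed.

Lemma ge0_integral_setX_r : (\int[m1 \x m2]_(z in A `*` B) f z =
  \int[m2]_(y in B) \int[m1]_(x in A) f (x, y))%E.
Proof.
rewrite integral_mkcond -/g fubini_tonelli2// [RHS]integral_mkcond.
by apply: eq_integral => y _; exact: int_gr.
Qed.

End fubini_on.

Lemma measurable_integral_section d1 d2 (T1 : measurableType d1)
    (T2 : measurableType d2) (R : realType)
    (m2 : {sigma_finite_measure set T2 -> \bar R})
    (B : set T2) (f : T1 * T2 -> \bar R) :
  measurable B -> measurable_fun setT f -> (forall z, (0 <= f z)%E) ->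
  measurable_fun setT (fun x => \int[m2]_(y in B) f (x, y))%E.
Proof.
move=> mB mf f0.
rewrite (_ : (fun _ => _) = fubini_F m2 (f \_ (setT `*` B))); last first.
  apply/funext => x; rewrite /fubini_F [LHS]integral_mkcond.
  by apply: eq_integral => y _; rewrite !patchE in_setX in_setT.
apply: measurable_fun_fubini_tonelli_F.
  apply/(measurable_restrict _ _ measurableT); first exact: measurableX.
  by rewrite setTI; exact: measurable_funTS.
by move=> z; rewrite patchE; case: ifP.
Qed.

Lemma measurable_Qmap (R : realType) :
  measurable_fun setT (@Qmap R : measurableTypeR R * measurableTypeR R ->
    measurableTypeR R * measurableTypeR R * measurableTypeR R).
Proof.
apply: measurable_fun_pair; first apply: measurable_fun_pair.
- by apply: measurable_funB; exact: measurable_funX.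
- by apply: measurable_funM => //; exact: measurable_funM.
- by apply: measurable_funD; exact: measurable_funX.
Qed.

Section polar.
Variable R : realType.
Local Notation mR := (measurableTypeR R).
Let leb : {sigma_finite_measure set mR -> \bar R} := @lebesgue_measure R.
Variable H : mR * mR * mR -> \bar R.
Hypotheses (mH : measurable_fun setT H) (H0 : forall p, (0 <= H p)%E).

Let mHQ : measurable_fun setT (H \o (@Qmap R : mR * mR -> mR * mR * mR)).
Proof. by apply: measurableT_comp => //; exact: measurable_Qmap. Qed.

Let mHc : measurable_fun setT (H \o @cone_param R).
Proof. by apply: measurableT_comp => //; exact: measurable_cone_param. Qed.

Let K (v : mR) : \bar R := (\int[leb]_u H (Qmap (u, v)))%E.

Let mK : measurable_fun setT K.
Proof. exact: (@measurable_fun_fubini_tonelli_G _ _ _ _ _ leb _ mHQ (fun z => H0 _)). Qed.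

Let K0 v : (0 <= K v)%E.
Proof. by apply: integral_ge0 => u _. Qed.

Let mHQv v : measurable_fun setT (fun u : mR => H (Qmap (u, v))).
Proof. exact: (measurableT_comp mHQ (pair2_measurable v)). Qed.

(** Q identifies opposite points, so u -> -u carries the line at height -v to the line at height
    v. *)
Let KN v : K (- v) = K v.
Proof.
rewrite {1}/K (@ge0_integral_affine R (-1) 0) ?oppr_eq0 ?oner_neq0//.
apply: eq_integral => u _; rewrite normrN normr1 mule1 addr0 mulN1r.
by congr (H _); rewrite /Qmap/= !sqrrN mulrN mulrN mulNr opprK.
Qed.

Let int_K : (\int[leb]_v K v = 2%:E * \int[leb]_(v in `]0%R, +oo[) K v)%E.
Proof.
have -> : [set: mR] = `]-oo, 0%R]%classic `|` `]0%R, +oo[%classic.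
  apply/esym/seteqP; split => // x _ /=; rewrite !in_itv/= andbT.
  by case: leP; [left|right].
rewrite ge0_integral_setU//=; last first.
- apply/disj_setPS => x [] /=; rewrite !in_itv/= andbT => x0.
  by rewrite ltNge x0.
- exact: measurable_funTS.
rewrite mule_natl mule2n; congr (_ + _)%E.
under eq_integral do rewrite -KN.
rewrite -(ge0_integration_by_substitution0 mK K0).
by rewrite -integral_itv_obnd_cbnd//; exact: measurable_funTS.
Qed.

(* [H] at the cone point of height t whose preimages lie on the line u = s v. *)
Let M (s t : R) : \bar R :=
  H (t * (s ^+ 2 - 1) / (1 + s ^+ 2), t * (2 * s) / (1 + s ^+ 2), t).

Let mM : measurable_fun setT (fun z : mR * mR => M z.1 z.2).
Proof.
have mV : measurable_fun setT (fun z : mR * mR => (1 + z.1 ^+ 2)^-1).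
  apply: (@measurableT_comp _ _ _ _ _ _ (fun s : mR => (1 + s ^+ 2)^-1) _ fst) => //.
  by apply: continuous_measurable_fun => x; exact: continuous_oneDsqrV.
apply: measurableT_comp => //; apply: measurable_fun_pair => //.
apply: measurable_fun_pair; apply: measurable_funM => //.
  by apply: measurable_funM => //; apply: measurable_funB => //; exact: measurable_funX.
by apply: measurable_funM => //; exact: measurable_funM.
Qed.

Let K_slope (v : R) : 0 < v -> K v = (\int[leb]_s (H (Qmap ((v * s)%R, v)) * v%:E))%E.
Proof.
move=> v0; rewrite /K (@ge0_integral_affine R v 0) ?gt_eqF//.
by apply: eq_integral => s _; rewrite addr0 gtr0_norm.
Qed.

(** At fixed slope the height of Q(v s, v) is t = (1 + s^2) v^2, whence dt = 2 (1 + s^2) v dv; the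
    factor v is the Jacobian of u = v s. *)
Let int_slope (s : R) : (\int[leb]_(v in `]0%R, +oo[) (H (Qmap ((v * s)%R, v)) * v%:E) =
  ((2 * (1 + s ^+ 2))^-1)%R%:E * \int[leb]_(t in `]0%R, +oo[) M s t)%E.
Proof.
have s1 : 0 < 1 + s ^+ 2 by rewrite ltr_pwDl// sqr_ge0.
have mMs : measurable_fun setT (M s : mR -> \bar R).
  exact: (measurableT_comp mM (pair1_measurable s)).
rewrite (@ge0_integral_sqr R (1 + s ^+ 2) _ s1 mMs (fun t => H0 _)).
rewrite -ge0_integralZl//; first last.
- by rewrite lee_fin invr_ge0 mulr_ge0// ltW.
- move=> v /=; rewrite in_itv/= andbT => v0.
  by rewrite mule_ge0 ?H0// lee_fin !mulr_ge0// ltW.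
- apply: emeasurable_funM; last by apply/measurable_EFinP/measurable_funTS; exact: measurable_funM.
  apply: measurable_funTS; apply: (measurableT_comp mMs).
  by apply: measurable_funM => //; exact: measurable_funX.
- apply: eq_integral => v /[!inE]/=; rewrite in_itv/= andbT => v0.
  rewrite muleCA -EFinM; congr (_ * _)%E; last first.
    by congr EFin; field; rewrite gt_eqF.
  rewrite /M; congr (H _); rewrite /Qmap/=.
  have s1' : 1 + s ^+ 2 != 0 by rewrite gt_eqF.
  by congr (_, _, _); field.
Qed.

Let N (phi : R) : \bar R := (\int[leb]_(t in `]0%R, +oo[) H (cone_param (t, phi)))%E.

Let mN : measurable_fun setT (N : mR -> \bar R).
Proof.
apply: (@measurable_integral_section _ _ mR mR R leb _ (fun z => H (cone_param (z.2, z.1)))) => //.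
by apply: (@measurableT_comp _ _ _ _ _ _ (H \o @cone_param R) _
  (fun z : mR * mR => (z.2, z.1))) => //; exact: measurable_fun_pair.
Qed.

(** With s = u / v = tan th, the angle th is measured from the v-axis: the polar angle of (u, v) is
    pi/2 - th, and Q doubles it to pi - 2 th. *)
Let N_tan (th : R) : - (pi / 2) < th < pi / 2 ->
  N (-2 * th + pi) = (\int[leb]_(t in `]0%R, +oo[) M (tan th) t)%E.
Proof.
move=> /cos_gt0_pihalf c0; apply: eq_integral => t _; congr (H _).
have c2 : cos th ^+ 2 + sin th ^+ 2 = 1 by rewrite cos2Dsin2.
have ct : 1 + tan th ^+ 2 = (cos th ^+ 2)^-1.
  by rewrite -cos2_tan2 ?gt_eqF.
rewrite /cone_param/= ct invrK cosDpi sinDpi.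
have -> : -2 * th = - (th *+ 2) by rewrite mulNr mulr_natl.
rewrite cosN sinN opprK cos_mulr2n sin_mulr2n.
have tc : tan th * cos th = sin th by rewrite /tan divfK// gt_eqF.
congr (_, _, _).
- rewrite -mulrA; congr (_ * _).
  by rewrite mulrBl -exprMn tc mul1r sin2cos2; ring.
- rewrite -mulrA; congr (_ * _).
  by rewrite expr2 mulrA -(mulrA 2) tc; ring.
Qed.

(** The constant 1/2 is the number 2 of preimages times the Jacobian 1/4 of du dv = dt dphi / 4. *)
Lemma ge0_integral_Qmap :
  (\int[leb \x leb]_z H (Qmap z) =
   2^-1%:E * \int[leb]_(phi in `[0%R, (2 * pi)%R[)
     \int[leb]_(t in `]0%R, +oo[) H (cone_param (t, phi)))%E.
Proof.
have mMt : measurable_fun setT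
    (fun s : mR => \int[leb]_(t in `]0%R, +oo[) M s t)%E.
  apply: (@measurable_integral_section _ _ mR mR R leb _ (fun z => M z.1 z.2)) => // z.
  exact: H0.
have int_M0 s : (0 <= \int[leb]_(t in `]0%R, +oo[) M s t)%E.
  by apply: integral_ge0 => t _; exact: H0.
have int_tan : (\int[leb]_(v in `]0%R, +oo[) K v =
    2^-1%:E * \int[leb]_(th in `](- (pi / 2))%R, (pi / 2)%R[)
      \int[leb]_(t in `]0%R, +oo[) M (tan th) t)%E.
  under eq_integral => v /[!inE]/= v0.
    rewrite K_slope; last by move: v0; rewrite in_itv/= andbT.
    over.
  pose f (z : mR * mR) := (H (Qmap ((z.2 * z.1)%R, z.2)) * z.2%:E)%E.
  have mf : measurable_fun setT f.
    apply: emeasurable_funM; last by apply/measurable_EFinP.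
    apply: (@measurableT_comp _ _ _ _ _ _ (H \o (@Qmap R : mR * mR -> mR * mR * mR)) _
      (fun z : mR * mR => (z.2 * z.1, z.2))) => //.
    by apply: measurable_fun_pair => //; exact: measurable_funM.
  have f0 z : (setT `*` `]0, +oo[%classic) z -> (0 <= f z)%E.
    move=> [_] /=; rewrite in_itv/= andbT => z0.
    by apply: mule_ge0; [exact: H0|rewrite lee_fin ltW].
  (* Tonelli exchanges v and s, so that the height can be substituted for v at fixed slope. *)
  rewrite -[LHS](ge0_integral_setX_r leb leb measurableT (measurable_itv _) mf f0).
  rewrite (ge0_integral_setX_l leb leb measurableT (measurable_itv _) mf f0).
  under eq_integral => s _.
    rewrite /f/= int_slope invfM EFinM -muleA; over.
  have mV : measurable_fun setT (fun s : mR => (1 + s ^+ 2)^-1).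
    by apply: continuous_measurable_fun => x; exact: continuous_oneDsqrV.
  have s1 (s : R) : 0 < 1 + s ^+ 2 by rewrite ltr_pwDl// sqr_ge0.
  have V0 (s : R) : 0 <= (1 + s ^+ 2)^-1 by rewrite invr_ge0 ltW.
  have mG : measurable_fun setT (fun s : mR => ((1 + s ^+ 2)^-1)%R%:E *
      \int[leb]_(t in `]0%R, +oo[) M s t)%E.
    by apply: emeasurable_funM => //; exact/measurable_EFinP.
  rewrite ge0_integralZl//; last first.
    by move=> s _; rewrite mule_ge0 ?lee_fin.
  congr (_ * _)%E; rewrite ge0_integral_tan//; last first.
    by move=> s; rewrite mule_ge0 ?lee_fin.
  (* The Jacobian 1 + tan^2 of s = tan th cancels the factor 1 / (1 + s^2) left by the height
     substitution. *)
  apply: eq_integral => th _; rewrite muleC muleA -EFinM mulfV ?mul1e//.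
  by rewrite gt_eqF.
have int_N : (\int[leb]_(phi in `[0%R, (2 * pi)%R[) N phi =
    2%:E * \int[leb]_(th in `](- (pi / 2))%R, (pi / 2)%R[)
      \int[leb]_(t in `]0%R, +oo[) M (tan th) t)%E.
  under [in RHS]eq_integral => th /[!inE]/= thpi.
    rewrite -N_tan; last by move: thpi; rewrite in_itv.
    over.
  (* The null endpoint phi = 0 is dropped, since phi = pi - 2 th maps the open th-interval onto ]0,
     2 pi[. *)
  rewrite -integral_itv_obnd_cbnd; last exact: measurable_funTS.
  rewrite [LHS]integral_mkcond (@ge0_integral_affine R (-2) pi); first last.
  - by move=> x; rewrite patchE; case: ifP => // _; apply: integral_ge0.
  - by apply/(measurable_restrict _ _ measurableT) => //; rewrite setTI; exact: measurable_funTS.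
  - by rewrite oppr_eq0.
  rewrite -ge0_integralZl//; first last.
  - by move=> th _; apply: integral_ge0.
  - apply: measurable_funTS; apply: (measurableT_comp mN).
    by apply: measurable_funD => //; exact: measurable_funM.
  rewrite [RHS]integral_mkcond; apply: eq_integral => th _.
  rewrite !patchE muleC normrN normr_nat.
  have -> : (-2 * th + pi \in `]0, (2 * pi)[%classic) =
            (th \in `](- (pi / 2)), (pi / 2)[%classic).
    by rewrite !mem_setE !in_itv/=; apply/idP/idP => /andP[? ?]; apply/andP; split; lra.
  by case: ifP => _; rewrite ?mule0.
rewrite fubini_tonelli2// -/K int_K int_tan int_N !muleA -!EFinM.
by congr (_%:E * _)%E; field.
Qed.
End polar.

(** * Transport of disk integrals to the cone *)

Lemma measurable_cone (R : realType) :
  measurable (@cone R : set (measurableTypeR R * measurableTypeR R * measurableTypeR R)).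
Proof.
rewrite (_ : @cone R = (fun p => p.1.1 ^+ 2 + p.1.2 ^+ 2 - p.2 ^+ 2) @^-1` [set 0]
    `&` snd @^-1` `[0, 1]%classic); last first.
  apply/seteqP; split => p; rewrite /cone/= in_itv/= => -[p0 ->]; split => //.
    by rewrite p0 subrr.
  exact/subr0_eq.
apply: measurableI; rewrite -[X in measurable X]setTI.
- have : measurable_fun setT
    (fun p : measurableTypeR R * measurableTypeR R * measurableTypeR R =>
      p.1.1 ^+ 2 + p.1.2 ^+ 2 - p.2 ^+ 2).
    apply: measurable_funB; last exact: measurable_funX.
    apply: measurable_funD; apply: measurable_funX;
    by apply: measurableT_comp => //.
  by apply => //; exact: measurable_set1.
- by apply: (@measurable_snd _ _ _ (measurableTypeR R)) => //; exact: measurable_itv.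
Qed.

Lemma cone_Qmap (R : realType) (z : R * R) : cone (Qmap z) <-> disk z.
Proof.
rewrite /cone /disk /Qmap/=; split => [[_ /andP[]]//|z1]; split; first by ring.
by rewrite z1 addr_ge0// sqr_ge0.
Qed.

Lemma cone_cone_param (R : realType) (p : R * R) :
  0 <= p.1 <= 1 -> cone (@cone_param R p).
Proof.
by move=> p1; split => //=; rewrite !exprMn -mulrDr cos2Dsin2 mulr1.
Qed.

Section transfer.
Variables (R : realType) (g : R) (hg : -1 < g).
Local Notation mR := (measurableTypeR R).
Let leb : {sigma_finite_measure set mR -> \bar R} := @lebesgue_measure R.

Lemma ge0_integral_disk_measure (F : mR * mR -> \bar R) :
  measurable_fun setT F -> (forall z, 0 <= F z)%E ->
  (\int[disk_measure hg]_(z in @disk R) F z =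
   \int[leb \x leb]_(z in @disk R) (F z * (mu_density g z)%:E))%E.
Proof.
move=> mF F0; have md := @measurable_disk R.
rewrite integral_mkcond (@ge0_integral_density_on _ _ _ (leb \x leb)%E
  (disk_measure hg) (@disk R) (mu_density g))//.
- by apply: eq_integral => z zD; rewrite patchE zD.
- exact: measurable_mu_density.
- by move=> z _; exact: mu_density_ge0.
- apply/(measurable_restrict _ _ measurableT) => //; rewrite setTI.
  exact: measurable_funTS.
- by move=> z; rewrite patchE; case: ifP.
Qed.

Lemma ge0_integral_param_measure (F : mR * mR -> \bar R) :
  measurable_fun setT F -> (forall z, 0 <= F z)%E ->
  (\int[param_measure hg]_z F z =
   \int[leb \x leb]_(z in @nu_domain R) (F z * (nu_density g z)%:E))%E.
Proof.
move=> mF F0; apply: ge0_integral_density_on => //.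
- exact: measurable_nu_domain.
- exact: measurable_nu_density.
- by move=> p _; exact: nu_density_ge0.
Qed.

Lemma ge0_integral_cone_measure (F : mR * mR * mR -> \bar R) :
  measurable_fun setT F -> (forall z, 0 <= F z)%E ->
  (\int[cone_measure hg]_(p in @cone R) F p =
   \int[leb \x leb]_(z in @nu_domain R) (F (cone_param z) * (nu_density g z)%:E))%E.
Proof.
move=> mF F0; have mc := @measurable_cone R.
pose mcp := isMeasurableFun.Build _ _ _ _ _ (@measurable_cone_param R).
pose cp : {mfun (mR * mR)%type >-> (mR * mR * mR)%type} := HB.pack (@cone_param R) mcp.
transitivity (\int[pushforward (param_measure hg) cp]_(p in @cone R) F p)%E.
  exact: eq_measure_integral.
rewrite ge0_integral_pushforward//; first last.
- exact: measurable_funTS.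
rewrite integral_mkcond ge0_integral_param_measure; first last.
- by move=> z; rewrite patchE; case: ifP => // _; exact: F0.
- apply/(measurable_restrict _ _ measurableT) => //.
    by rewrite -[X in measurable X]setTI; exact: measurable_cone_param.
  rewrite setTI; apply: measurable_funTS; apply: measurableT_comp => //.
(* The parameter domain has 0 <= t <= 1, so its points all land on the cone and the restriction to
   the cone disappears. *)
apply: eq_integral => z /[!inE] -[/= z1 _].
rewrite patchE mem_set//=; apply: cone_cone_param.
by move: z1; rewrite in_itv.
Qed.

(** The density of mu at z depends only on the height of Q(z), so it can be absorbed into a function
    on the cone before passing to polar coordinates. *)
Lemma ge0_disk_integral_Qmap (G : mR * mR * mR -> \bar R) :
  measurable_fun setT G -> (forall p, 0 <= G p)%E ->
  (\int[disk_measure hg]_(z in @disk R) G (Qmap z) =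
   \int[cone_measure hg]_(p in @cone R) G p)%E.
Proof.
move=> mG G0.
have mGQ : measurable_fun setT (G \o (@Qmap R : mR * mR -> mR * mR * mR)).
  by apply: measurableT_comp => //; exact: measurable_Qmap.
rewrite [RHS](ge0_integral_cone_measure mG G0).
transitivity (\int[leb \x leb]_(z in @disk R) (G (Qmap z) * (mu_density g z)%:E))%E.
  exact: (ge0_integral_disk_measure mGQ (fun z => G0 _)).
pose w (t : R) := (g + 1) / pi * (1 - t) `^ g.
have mw : measurable_fun setT (w : mR -> R).
  apply: measurable_funM => //; apply: (measurableT_comp (measurable_powR g)).
  exact: measurable_funB.
have w0 t : 0 <= w t.
  rewrite mulr_ge0 ?powR_ge0// divr_ge0 ?pi_ge0//.
  by rewrite -lerBlDr sub0r ltW.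
pose S : set (mR * mR * mR) := [set p | p.2 <= 1].
have mS : measurable S.
  rewrite (_ : S = snd @^-1` `]-oo, 1%R]%classic); last first.
    by apply/seteqP; split => p; rewrite /S/= in_itv.
  by rewrite -[X in measurable X]setTI; apply: measurable_snd => //; exact: measurable_itv.
(* The cut-off at height 1 turns the integral over the disk into one over the whole plane, since
   Q(z) lies in [S] exactly when z is in the disk. *)
pose H := (fun p : mR * mR * mR => G p * (w p.2)%:E)%E \_ S.
have mH : measurable_fun setT H.
  apply/(measurable_restrict _ _ measurableT) => //; rewrite setTI.
  apply: measurable_funTS; apply: emeasurable_funM => //.
  by apply/measurable_EFinP; exact: measurableT_comp.
have H0 p : (0 <= H p)%E.
  by rewrite /H patchE; case: ifP => // _; rewrite mule_ge0// lee_fin.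
transitivity (\int[leb \x leb]_z H (Qmap z))%E.
  rewrite integral_mkcond; apply: eq_integral => z _; rewrite /H !patchE.
  rewrite (_ : (Qmap z \in S) = (z \in @disk R)); last by rewrite !mem_setE.
  by case: ifP => // _; rewrite /mu_density /w /Qmap/= opprD addrA.
rewrite (ge0_integral_Qmap mH H0).
pose F z := (G (cone_param z) * (nu_density g z)%:E)%E.
have mF : measurable_fun setT F.
  apply: emeasurable_funM; last by apply/measurable_EFinP; exact: measurable_nu_density.
  by apply: measurableT_comp => //; exact: measurable_cone_param.
have F0 z : (0 <= F z)%E by rewrite mule_ge0 ?G0 ?lee_fin ?nu_density_ge0.
rewrite (ge0_integral_setX_r leb leb _ _ mF)//.
under eq_integral => phi _.
  (* [H] vanishes above height 1, and 2 is the ratio of the constants (g + 1) / pi and (g + 1) / (2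
     pi); it cancels the 1/2 of the polar formula. *)
  have -> : (\int[leb]_(t in `]0%R, +oo[) H (cone_param (t, phi)) =
             2%:E * \int[leb]_(t in `[0%R, 1%R]) F (t, phi))%E.
    have mFphi : measurable_fun setT (fun t : mR => F (t, phi)).
      exact: (measurableT_comp mF (pair2_measurable phi)).
    rewrite -integral_itv_obnd_cbnd; last exact: measurable_funTS.
    rewrite -ge0_integralZl//; last exact: measurable_funTS.
    rewrite [LHS]integral_mkcond [RHS]integral_mkcond.
    apply: (@eq_integral _ _ R leb) => t _.
    have tS : (cone_param (t, phi) \in S) = (t <= 1) by apply/idP/idP => /[!inE].
    rewrite /H !patchE tS !mem_setE !in_itv/= andbT.
    case: ifP => t0 /=; last by [].
    case: ifP => t1; last by [].
    rewrite /F muleCA -EFinM /nu_density /w/=; congr (_ * _%:E)%E.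
    have := lt0r_neq0 (pi_gt0 R); generalize (@pi R) => q q0.
    by field.
  over.
rewrite ge0_integralZl//; first last.
- by move=> phi _; apply: integral_ge0.
- apply: measurable_funTS.
  apply: (@measurable_integral_section _ _ mR mR R leb _ (fun z => F (z.2, z.1))) => //.
  apply: (@measurableT_comp _ _ _ _ _ _ F _ (fun z : mR * mR => (z.2, z.1))) => //.
  exact: measurable_fun_pair.
by rewrite muleA -EFinM mulVf ?mul1e.
Qed.

(* No integrability is needed: the integral is by definition the difference of the
   integrals of the positive and negative parts, which are transferred separately. *)
Lemma disk_integral_Qmap (f : mR * mR * mR -> R) : measurable_fun setT f ->
  disk_integral hg (f \o @Qmap R) = cone_integral hg f.
Proof.
move=> mf; rewrite /disk_integral /cone_integral [LHS]integralE [RHS]integralE.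
have mfE : measurable_fun setT (EFin \o f) by exact/measurable_EFinP.
congr (_ - _)%E.
- rewrite -[RHS](@ge0_disk_integral_Qmap (EFin \o f)^\+%E) => [|//|//].
    by apply: eq_integral => z _; rewrite !funeposE.
  exact: measurable_funepos.
- rewrite -[RHS](@ge0_disk_integral_Qmap (EFin \o f)^\-%E) => [|//|//].
    by apply: eq_integral => z _; rewrite !funenegE.
  exact: measurable_funeneg.
Qed.

End transfer.

(** * Parity and monomial integrals on the disk *)

Section disk_polynomials.
Variables (R : realType) (g : R) (hg : -1 < g).
Local Notation mR := (measurableTypeR R).
Let leb : {sigma_finite_measure set mR -> \bar R} := @lebesgue_measure R.

Let ge0_integral_leb2N (F : mR * mR -> \bar R) :
  measurable_fun setT F -> (forall z, 0 <= F z)%E ->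
  (\int[leb \x leb]_z F z = \int[leb \x leb]_z F (- z.1, - z.2)%R)%E.
Proof.
move=> mF F0.
have m1 : measurable_fun setT (fun z : mR * mR => F (- z.1, - z.2)).
  apply: (@measurableT_comp _ _ _ _ _ _ F _ (fun z : mR * mR => (- z.1, - z.2))) => //.
  by apply: measurable_fun_pair; exact: measurableT_comp.
have neg1 (G : mR -> \bar R) : measurable_fun setT G -> (forall x, 0 <= G x)%E ->
    (\int[leb]_x G x = \int[leb]_x G (- x)%R)%E.
  move=> mG G0; rewrite (@ge0_integral_affine R (-1) 0) ?oppr_eq0 ?oner_neq0//.
  by apply: eq_integral => x _; rewrite normrN normr1 mule1 addr0 mulN1r.
rewrite fubini_tonelli2// [RHS]fubini_tonelli2//.
rewrite neg1//; first last.
- by move=> v; apply: integral_ge0 => u _; exact: F0.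
- exact: (@measurable_fun_fubini_tonelli_G _ _ _ _ _ leb F mF F0).
apply: eq_integral => v _; rewrite /fubini_G.
rewrite [LHS]neg1//; exact: (measurableT_comp mF (pair2_measurable _)).
Qed.

(** The disk and the density involve only squares of the coordinates, and Lebesgue measure is
    invariant under reflection in each variable. *)
Lemma ge0_integral_diskN (F : mR * mR -> \bar R) :
  measurable_fun setT F -> (forall z, 0 <= F z)%E ->
  (\int[disk_measure hg]_(z in @disk R) F z =
   \int[disk_measure hg]_(z in @disk R) F (- z.1, - z.2)%R)%E.
Proof.
move=> mF F0.
have mN : measurable_fun setT (fun z : mR * mR => F (- z.1, - z.2)).
  apply: (@measurableT_comp _ _ _ _ _ _ F _ (fun z : mR * mR => (- z.1, - z.2))) => //.
  by apply: measurable_fun_pair; exact: measurableT_comp.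
rewrite [LHS](ge0_integral_disk_measure hg mF F0).
rewrite [RHS](ge0_integral_disk_measure hg mN (fun z => F0 _)).
rewrite [LHS]integral_mkcond [RHS]integral_mkcond.
rewrite [LHS]ge0_integral_leb2N.
- apply: eq_integral => z _; rewrite !patchE.
  rewrite (_ : ((- z.1, - z.2) \in @disk R) = (z \in @disk R)); last first.
    by apply/idP/idP; rewrite !inE /disk/= !sqrrN.
  by rewrite /mu_density/= !sqrrN.
- apply/(measurable_restrict _ _ measurableT); first exact: measurable_disk.
  rewrite setTI; apply: measurable_funTS; apply: emeasurable_funM => //.
  by apply/measurable_EFinP; exact: measurable_mu_density.
- move=> z; rewrite patchE; case: ifP => // _.
  by rewrite mule_ge0 ?F0// lee_fin mu_density_ge0.
Qed.

(** The negative part of an odd function is its positive part composed with z -> -z. Integrability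
    makes the two equal integrals finite, so their extended-real difference is 0. *)
Lemma disk_integral_odd (f : mR * mR -> R) :
  (disk_measure hg).-integrable (@disk R) (EFin \o f) ->
  measurable_fun setT f -> (forall z, f (- z.1, - z.2) = - f z) ->
  disk_integral hg f = 0%E.
Proof.
move=> fi mf fN; have mfE : measurable_fun setT (EFin \o f) by exact/measurable_EFinP.
rewrite /disk_integral integralE.
rewrite (_ : (\int[disk_measure hg]_(z in @disk R) (EFin \o f)^\- z =
              \int[disk_measure hg]_(z in @disk R) (EFin \o f)^\+ z)%E).
  rewrite subee//; exact: (integrable_pos_fin_num (@measurable_disk R) fi).
rewrite [RHS]ge0_integral_diskN//; last exact: measurable_funepos.
by apply: eq_integral => z _; rewrite funenegE funeposE /= fN EFinN.
Qed.

Definition monomial2 (m : multinom 2) (z : R * R) : R :=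
  \prod_i coord2 z i ^+ m i.

Lemma monomial2E m z :
  monomial2 m z = z.1 ^+ m ord0 * z.2 ^+ m (lift ord0 ord0).
Proof. by rewrite /monomial2 big_ord_recl big_ord1. Qed.

Lemma measurable_monomial2 m :
  measurable_fun setT (monomial2 m : mR * mR -> R).
Proof.
rewrite (_ : monomial2 m = fun z => z.1 ^+ m ord0 * z.2 ^+ m (lift ord0 ord0)).
  by apply: measurable_funM; exact: measurable_funX.
by apply/funext => z; exact: monomial2E.
Qed.

(** Finiteness will come from exactness of a given rule on constants, without computing the mass. *)
Hypothesis fin_disk : (disk_measure hg (@disk R) < +oo)%E.

Lemma integrable_monomial2 m :
  (disk_measure hg).-integrable (@disk R) (EFin \o monomial2 m).
Proof.
apply: measurable_bounded_integrable => //; first exact: measurable_disk.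
  by apply: measurable_funTS; exact: measurable_monomial2.
exists 1; split; first exact: num_real.
move=> M M1 z; rewrite /disk/= => z1; apply: le_trans (ltW M1).
rewrite monomial2E normrM !normrX.
have le1 (x y : R) : x ^+ 2 + y ^+ 2 <= 1 -> `|x| <= 1.
  move=> xy; rewrite -(@ler_pXn2r _ 2)// ?nnegrE// expr1n real_normK ?num_real//.
  by apply: le_trans xy; rewrite lerDl sqr_ge0.
by rewrite mulr_ile1 ?exprn_ile1 ?exprn_ge0// (le1 z.1 z.2, le1 z.2 z.1)// addrC.
Qed.

Lemma disk_integral_meval (p : mpoly 2 R) :
  disk_integral hg (fun z => meval (coord2 z) p) =
  (\sum_(m <- msupp p) (mcoeff m p)%:E * disk_integral hg (monomial2 m))%E.
Proof.
rewrite /disk_integral.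
transitivity (\int[disk_measure hg]_(z in @disk R)
    \sum_(m <- msupp p) ((mcoeff m p)%:E * (monomial2 m z)%:E))%E.
  apply: eq_integral => z _; rewrite mevalE -sumEFin.
  by apply: eq_bigr => m _; rewrite EFinM.
have mD := @measurable_disk R.
rewrite integral_sum//; last first.
  by move=> m; apply: integrableZl => //; exact: integrable_monomial2.
by apply: eq_bigr => m _; rewrite integralZl//; exact: integrable_monomial2.
Qed.

End disk_polynomials.

(** * Rules *)

Section rules.
Variables (R : realType) (T : choiceType).
Implicit Types (w : rule R T) (s : seq (T * R)) (f : T -> R).

Lemma mem_merge_terms s x : (x \in domf (merge_terms s)) = (x \in unzip1 s).
Proof. by rewrite -(seq_fsetE tt). Qed.

(** After exchanging the two sums, each term of the list is counted at exactly one node, so merging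
    leaves the functional unchanged. *)
Lemma rule_sum_merge_terms s f :
  rule_sum (merge_terms s) f = \sum_(p <- s) p.2 * f p.1.
Proof.
rewrite /rule_sum.
under eq_bigr do rewrite ffunE mulr_suml.
rewrite (exchange_big_dep predT)//= [LHS]big_seq [RHS]big_seq.
apply: eq_bigr => p ps.
have px : p.1 \in domf (merge_terms s) by rewrite mem_merge_terms map_f.
by rewrite (big_pred1 [` px]%fset).
Qed.

Lemma rule_sum_terms w f : rule_sum w f = \sum_(p <- rule_terms w) p.2 * f p.1.
Proof. by rewrite /rule_sum /rule_terms big_map big_enum. Qed.

Lemma merge_terms_gt0 s : (forall p, p \in s -> 0 < p.2) ->
  forall x : domf (merge_terms s), 0 < merge_terms s x.
Proof.
move=> s0 x; rewrite ffunE.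
have : val x \in unzip1 s by rewrite -mem_merge_terms; exact: valP.
case/mapP => p ps xp; rewrite (big_rem p)//= -xp eqxx ltr_wpDr ?s0//.
rewrite big_seq_cond sumr_ge0// => q /andP[qs _].
by rewrite ltW// s0// (mem_rem qs).
Qed.

Lemma rule_terms_gt0 w : (forall x, 0 < w x) ->
  forall p, p \in rule_terms w -> 0 < p.2.
Proof. by move=> w0 p /mapP[x _ ->]/=. Qed.

Lemma unzip1_rule_terms w x : (x \in unzip1 (rule_terms w)) = (x \in domf w).
Proof.
rewrite /unzip1 /rule_terms -map_comp; apply/mapP/idP => [[y _ ->]|xw].
  exact: valP.
by exists [` xw]%fset => //; rewrite mem_enum.
Qed.

(* The weight at [x] is the rule applied to the indicator of [x]; positivity makes it
   nonzero exactly on the nodes, so that a positive rule is determined by its sums. *)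
Lemma fnd_positive_rule w x (c := rule_sum w (fun y => (y == x)%:R)) :
  (forall y, 0 < w y) -> w.[? x]%fmap = if c == 0 then None else Some c.
Proof.
move=> w0; rewrite /c /rule_sum; have [xw|xw] := boolP (x \in domf w).
  rewrite (bigD1 [` xw]%fset)//= eqxx mulr1 big1 => [|y yx]; last first.
    by rewrite -val_eqE/= in yx; rewrite (negbTE yx) mulr0.
  by rewrite addr0 gt_eqF// in_fnd.
rewrite big1 ?eqxx ?not_fnd// => y _; case: eqP => [yx|]; rewrite ?mulr0//.
by move: xw; rewrite -yx (valP y).
Qed.

Lemma eq_positive_rule w1 w2 : (forall x, 0 < w1 x) -> (forall x, 0 < w2 x) ->
  (forall f, rule_sum w1 f = rule_sum w2 f) -> w1 = w2.
Proof.
by move=> w10 w20 w12; apply/fmapP => x; rewrite !fnd_positive_rule// w12.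
Qed.

End rules.

(** * Fibers and image of Q *)

Section Qmap_fibers.
Variable R : realType.
Implicit Types (z : R * R) (xi : R * R * R).

Lemma QmapN z : Qmap (- z) = Qmap z.
Proof. by rewrite /Qmap/= !sqrrN !mulrN mulNr opprK. Qed.

Lemma Qmap0 : Qmap (0 : R * R) = 0.
Proof. by rewrite /Qmap/= expr0n/= !mulr0 subrr addr0. Qed.

Lemma Qmap_eq0 z : (Qmap z == 0) = (z == 0).
Proof.
apply/eqP/eqP => [|->]; last exact: Qmap0.
case: z => u v [_ _ /eqP]; rewrite paddr_eq0 ?sqr_ge0// !sqrf_eq0.
by move=> /andP[/eqP -> /eqP ->].
Qed.

(** Q(u, v) determines u^2, v^2 and u v: the squares fix each coordinate up to sign and the product
    ties the two signs together. *)
Lemma Qmap_inj_sign z z' : Qmap z = Qmap z' -> z' = z \/ z' = - z.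
Proof.
case: z z' => u v [a b] []/= h1 h2 h3.
have ua : a ^+ 2 = u ^+ 2 by lra.
have vb : b ^+ 2 = v ^+ 2 by lra.
have uv : a * b = u * v by lra.
(* When a = 0 the product carries no information, but then only the sign of v is in question. *)
have [a0|a0] := eqVneq a 0.
  have u0 : u = 0 by apply/eqP; rewrite -sqrf_eq0 -ua a0 expr0n.
  move/eqP: vb; rewrite eqf_sqr a0 u0 => /orP[/eqP ->|/eqP ->]; [by left|right].
  by congr (_, _); rewrite oppr0.
move/eqP: ua; rewrite eqf_sqr => /orP[/eqP au|/eqP au]; [left|right].
  by congr (_, _) => //; apply: (mulfI a0); rewrite uv au.
by congr (_, _) => //; apply: (mulfI a0); rewrite uv au mulrNN.
Qed.

Lemma Qmap_surj xi : cone xi -> exists2 z, disk z & Qmap z = xi.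
Proof.
move=> cxi; suff [z zxi] : exists z, Qmap z = xi.
  by exists z => //; apply/cone_Qmap; rewrite zxi.
case: xi cxi => [[x y] t] [/= xyt /andP[t0 _]].
have [xt tx] : - t <= x /\ x <= t.
  apply/andP; rewrite -ler_norml -(@ler_pXn2r _ 2) ?nnegrE//.
  by rewrite real_normK ?num_real// -xyt lerDl sqr_ge0.
(* Half-angle formulas: t + x = 2 u^2 and t - x = 2 v^2; the sign of y then decides between v and
   -v. *)
pose u := Num.sqrt ((t + x) / 2); pose v := Num.sqrt ((t - x) / 2).
have u2 : u ^+ 2 = (t + x) / 2 by rewrite sqr_sqrtr//; lra.
have v2 : v ^+ 2 = (t - x) / 2 by rewrite sqr_sqrtr//; lra.
have uv : 2 * u * v = `|y|.
  apply/eqP; rewrite -(@eqrXn2 _ 2)//; last by rewrite !mulr_ge0 ?sqrtr_ge0.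
  by rewrite !exprMn u2 v2 real_normK ?num_real//; apply/eqP; nra.
have [y0|y0] := leP 0 y.
  exists (u, v); rewrite /Qmap/= u2 v2 uv ger0_norm//.
  by congr (_, _, _); field.
exists (u, - v); rewrite /Qmap/= sqrrN u2 v2 mulrN uv ltr0_norm// opprK.
by congr (_, _, _); field.
Qed.

End Qmap_fibers.

(** * Pushing and lifting rules *)

Section push_lift.
Variable R : realType.

Lemma rule_sum_push (w : rule R (R * R)%type) f :
  rule_sum (push_rule w) f = rule_sum w (f \o @Qmap R).
Proof. by rewrite rule_sum_merge_terms big_map rule_sum_terms. Qed.

(** The transpose of lifting, acting on functions: for a preimage choice [z] it averages [f] over
    the fiber of Q above each node. It sees [f] only through its even part. *)
Definition lift_fun (z : R * R * R -> R * R) (f : R * R -> R) (xi : R * R * R) : R :=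
  if xi == 0 then f 0 else (f (z xi) + f (- z xi)) / 2.

Lemma rule_sum_lift z (w : rule R (R * R * R)%type) f :
  rule_sum (lift_rule z w) f = rule_sum w (lift_fun z f).
Proof.
rewrite rule_sum_merge_terms big_flatten big_map rule_sum_terms.
apply: eq_bigr => p _; rewrite /lift_fun; case: ifP => _.
  by rewrite big_seq1.
by rewrite !big_cons big_nil/=; field.
Qed.

Lemma push_rule_gt0 (w : rule R (R * R)%type) : (forall x, 0 < w x) ->
  forall x, 0 < push_rule w x.
Proof.
move=> w0; apply: merge_terms_gt0 => _ /mapP[p pw ->]/=.
exact: rule_terms_gt0 pw.
Qed.

Lemma lift_rule_gt0 z (w : rule R (R * R * R)%type) : (forall x, 0 < w x) ->
  forall x, 0 < lift_rule z w x.
Proof.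
move=> w0; apply: merge_terms_gt0 => q /flatten_mapP[p /(rule_terms_gt0 w0) p0].
by case: ifP => _; rewrite !inE; [move=> /eqP ->|move=> /orP[]/eqP ->];
  rewrite /= ?divr_gt0.
Qed.

Lemma mem_push_rule (w : rule R (R * R)%type) xi :
  xi \in domf (push_rule w) -> exists2 x, x \in domf w & xi = Qmap x.
Proof.
rewrite mem_merge_terms => /mapP[_ /mapP[p pw ->] ->]/=.
by exists p.1 => //; rewrite -unzip1_rule_terms map_f.
Qed.

Lemma Qmap_mem_push_rule (w : rule R (R * R)%type) x :
  x \in domf w -> Qmap x \in domf (push_rule w).
Proof.
rewrite mem_merge_terms -unzip1_rule_terms => /mapP[p pw ->].
by rewrite /unzip1 -map_comp; apply/mapP; exists p.
Qed.

Lemma mem_lift_rule z (w : rule R (R * R * R)%type) x :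
  x \in domf (lift_rule z w) -> exists2 xi, xi \in domf w &
    (xi = 0 /\ x = 0) \/ (xi != 0 /\ (x = z xi \/ x = - z xi)).
Proof.
rewrite mem_merge_terms => /mapP[q /flatten_mapP[p pw] qp ->].
exists p.1; first by rewrite -unzip1_rule_terms map_f.
move: qp; case: eqP => [->|/eqP p0]; rewrite !inE; first by move=> /eqP ->; left.
by move=> /orP[/eqP ->|/eqP ->]; right; split=> //=; [left|right].
Qed.

Lemma disk0 : disk (0 : R * R).
Proof. by rewrite /disk/= expr0n addr0 ler01. Qed.

Lemma diskN (x : R * R) : disk (- x) <-> disk x.
Proof. by rewrite /disk/= !sqrrN. Qed.

Lemma mem_lift_rule_disk z (w : rule R (R * R * R)%type) x :
  preimage_choice w z -> x \in domf (lift_rule z w) -> disk x.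
Proof.
move=> zw /mem_lift_rule[xi xiw [[_ ->]|[xi0]]]; first exact: disk0.
by have [dz _] := zw _ xiw xi0 => -[] ->//; apply/diskN.
Qed.

(** The key [k] recovers from an element the block it came from, so blocks with distinct keys are
    disjoint. *)
Lemma uniq_flatten_map (U V K : eqType) (h : U -> K) (k : V -> K) (F : U -> seq V)
    (s : seq U) :
  uniq (map h s) -> (forall p, p \in s -> uniq (F p)) ->
  (forall p y, p \in s -> y \in F p -> k y = h p) -> uniq (flatten (map F s)).
Proof.
elim: s => //= p s IH /andP[ps us] uF kF.
rewrite cat_uniq uF ?mem_head//= IH//; last 2 first.
- by move=> q qs; apply: uF; rewrite in_cons qs orbT.
- by move=> q y qs; apply: kF; rewrite in_cons qs orbT.
rewrite andbT; apply/hasPn => y /flatten_mapP[q qs yq]; apply: contra ps => yp.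
rewrite -(kF p y (mem_head _ _) yp) (kF q y _ yq) ?map_f//.
by rewrite in_cons qs orbT.
Qed.

Lemma uniq_unzip1_rule_terms (T : choiceType) (w : rule R T) :
  uniq (unzip1 (rule_terms w)).
Proof.
by rewrite /unzip1 /rule_terms -map_comp map_inj_uniq ?enum_uniq.
Qed.

(** Q serves as the key separating blocks, and inside a block z and -z differ because only the
    origin maps to the apex. Hence merging never acts in a lift and the weights stay as
    prescribed. *)
Lemma uniq_lift_terms z (w : rule R (R * R * R)%type) :
  preimage_choice w z -> uniq (unzip1 (lift_terms z w)).
Proof.
move=> zw; rewrite /unzip1 /lift_terms map_flatten -map_comp.
have pw p : p \in rule_terms w -> p.1 != 0 -> Qmap (z p.1) = p.1.
  move=> pw p0; have [|//] := zw p.1 _ p0.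
  by rewrite -unzip1_rule_terms map_f.
apply: (@uniq_flatten_map _ _ _ fst (@Qmap R)).
- exact: uniq_unzip1_rule_terms.
- move=> p /pw Qp/=; have [//|p0] := eqVneq p.1 0.
  rewrite /= inE andbT; apply/eqP => zN.
  have z0 : z p.1 = 0.
    by move: zN; case: (z p.1) => a b [/= ha hb]; congr (_, _); lra.
  by move: (p0); rewrite -(Qp p0) z0 Qmap0 eqxx.
- move=> p y /pw Qp/=; have [->|p0] := eqVneq p.1 0.
    by rewrite inE => /eqP ->/=; rewrite Qmap0.
  by rewrite !inE => /orP[]/eqP ->/=; rewrite ?QmapN Qp.
Qed.

Lemma exists_preimage_choice (w : rule R (R * R * R)%type) :
  (forall xi, xi \in domf w -> cone xi) -> exists z, preimage_choice w z.
Proof.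
move=> wc.
have /choice[z zP] (xi : R * R * R) :
    exists z, cone xi -> disk z /\ Qmap z = xi.
  (* Off the cone the requirement is vacuous and 0 is a default value. *)
  have [/Qmap_surj[z dz Qz]|nc] := pselect (cone xi); last by exists 0.
  by exists z.
by exists z => xi /wc cxi _; exact: zP.
Qed.

(** Positive rules are compared through their sums: f o Q takes the same value f(xi) at both points
    of the fiber, so averaging returns it. *)
Lemma push_lift_rule z (w : rule R (R * R * R)%type) : (forall x, 0 < w x) ->
  preimage_choice w z -> push_rule (lift_rule z w) = w.
Proof.
move=> w0 zw; apply: eq_positive_rule => //.
  exact/push_rule_gt0/lift_rule_gt0.
move=> f; rewrite rule_sum_push rule_sum_lift; apply: eq_bigr => xi _.
congr (_ * _); rewrite /lift_fun; have [xi0|xi0] := eqVneq (val xi) 0.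
  by rewrite xi0 /= Qmap0.
have [_ Qxi] := zw _ (valP xi) xi0.
by rewrite /= QmapN Qxi; field.
Qed.

Lemma rule_sumN (w : rule R (R * R)%type) f : centrally_symmetric w ->
  rule_sum w (f \o -%R) = rule_sum w f.
Proof.
move=> sw.
(* The origin, exempt in the definition of central symmetry, is its own opposite; negation is
   therefore a weight-preserving involution of all nodes, along which the sum is reindexed. *)
have swN x : x \in domf w -> w.[? - x]%fmap = w.[? x]%fmap.
  by move=> xw; have [->|/sw->//] := eqVneq x 0; rewrite oppr0.
have memN (x : domf w) : - val x \in domf w.
  by rewrite -fndSome swN ?fndSome (valP x).
pose opp (x : domf w) : domf w := [` memN x]%fset.
have oppK : involutive opp by move=> x; apply: val_inj; rewrite /= opprK.
rewrite [RHS](reindex_inj (inv_inj oppK))/=; apply: eq_bigr => x _.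
congr (_ * _); apply/Some_inj.
have wE (y : domf w) : w.[? val y]%fmap = Some (w y).
  by rewrite (in_fnd (valP y)); congr (Some (w _)); exact: val_inj.
by rewrite -!wE /= -(swN _ (valP x)).
Qed.

(** Weights are sums of indicators by [fnd_positive_rule], and negation exchanges the indicators of
    x and -x. *)
Lemma centrally_symmetricP (w : rule R (R * R)%type) : (forall x, 0 < w x) ->
  (forall f, rule_sum w (f \o -%R) = rule_sum w f) -> centrally_symmetric w.
Proof.
move=> w0 wN x _ _; rewrite !fnd_positive_rule// -wN.
set a := rule_sum _ _; set b := rule_sum _ _; suff -> : a = b by [].
by apply: eq_bigr => y _; rewrite /= eqr_opp.
Qed.

Lemma centrally_symmetric_lift z (w : rule R (R * R * R)%type) :
  (forall x, 0 < w x) -> centrally_symmetric (lift_rule z w).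
Proof.
move=> w0; apply: centrally_symmetricP => [|f]; first exact: lift_rule_gt0.
rewrite !rule_sum_lift; apply: eq_bigr => xi _; rewrite /lift_fun/=.
by rewrite oppr0 opprK [f (- _) + _]addrC.
Qed.

(** Pushing and then lifting replaces [f] by its even part, whichever sign the choice takes on each
    fiber, and a centrally symmetric rule gives [f] and its even part the same sum. *)
Lemma lift_push_rule z (w : rule R (R * R)%type) : (forall x, 0 < w x) ->
  centrally_symmetric w -> preimage_choice (push_rule w) z ->
  lift_rule z (push_rule w) = w.
Proof.
move=> w0 sw zw; apply: eq_positive_rule => //.
  exact/lift_rule_gt0/push_rule_gt0.
move=> f; rewrite rule_sum_lift rule_sum_push.
transitivity (rule_sum w (fun x => (f x + f (- x)) / 2)).
  apply: eq_bigr => x _; congr (_ * _); rewrite /lift_fun/= Qmap_eq0.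
  case: eqVneq => [->|x0]; first by rewrite oppr0; field.
  have Qx0 : Qmap (val x) != 0 by rewrite Qmap_eq0.
  have [_ /esym/Qmap_inj_sign] := zw _ (Qmap_mem_push_rule (valP x)) Qx0.
  by move=> [->//|->]; rewrite opprK [f (- _) + _]addrC.
transitivity ((rule_sum w f + rule_sum w (f \o -%R)) / 2).
  rewrite /rule_sum -big_split/= mulr_suml; apply: eq_bigr => x _.
  by rewrite /= -mulrDr mulrA.
by rewrite (rule_sumN f sw); field.
Qed.

(** Two choices differ by a sign at each non-apex node, which the average over the pair ignores. *)
Lemma lift_rule_choice z z' (w : rule R (R * R * R)%type) : (forall x, 0 < w x) ->
  preimage_choice w z -> preimage_choice w z' -> lift_rule z w = lift_rule z' w.
Proof.
move=> w0 zw zw'; apply: eq_positive_rule; try exact: lift_rule_gt0.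
move=> f; rewrite !rule_sum_lift; apply: eq_bigr => xi _; congr (_ * _).
rewrite /lift_fun; case: eqVneq => [//|xi0].
have [_ Qz] := zw _ (valP xi) xi0; have [_ Qz'] := zw' _ (valP xi) xi0.
have : Qmap (z (val xi)) = Qmap (z' (val xi)) by rewrite Qz Qz'.
by move=> /Qmap_inj_sign[->//|->]; rewrite opprK [f (- _) + _]addrC.
Qed.

End push_lift.

(** * Polynomials on the disk and on the cone *)

Section polynomial_functions.
Variables (R : realType) (k : nat) (T : Type) (coord : T -> 'I_k -> R) (D : set T).
Local Notation Pi := (Pi_on coord D).

Lemma Pi_onW m m' f : (m <= m')%N -> Pi m f -> Pi m' f.
Proof. by move=> mm' [p pm fp]; exists p => //; exact: leq_trans pm _. Qed.

Lemma Pi_on_eq m f f' : (forall x, D x -> f x = f' x) -> Pi m f -> Pi m f'.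
Proof. by move=> ff' [p pm fp]; exists p => // x Dx; rewrite -ff'// fp. Qed.

Lemma Pi_on_cst m c : Pi m (fun=> c).
Proof.
exists (mpolyC k c) => [|x _]; last by rewrite mevalC.
by rewrite msizeC; case: (_ == _).
Qed.

Lemma Pi_on_coord i : Pi 1 (fun x => coord x i).
Proof.
exists (mpolyX R (mnm1 i)) => [|x _]; last by rewrite mevalXU.
by rewrite msizeX mdeg1.
Qed.

Lemma Pi_onD m f f' : Pi m f -> Pi m f' -> Pi m (fun x => f x + f' x).
Proof.
move=> [p pm fp] [p' pm' fp']; exists (p + p') => [|x Dx]; last first.
  by rewrite mevalD fp// fp'.
by rewrite (leq_trans (msizeD_le _ _))// geq_max pm.
Qed.

Lemma Pi_onM m m' f f' : Pi m f -> Pi m' f' -> Pi (m + m') (fun x => f x * f' x).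
Proof.
move=> [p pm fp] [p' pm' fp']; exists (p * p') => [|x Dx]; last first.
  by rewrite mevalM fp// fp'.
(* Zero factors are set apart because [msize] is degree plus one only for nonzero polynomials. *)
have [->|p0] := eqVneq p 0; first by rewrite mul0r msize0.
have [->|p'0] := eqVneq p' 0; first by rewrite mulr0 msize0.
rewrite msizeM//.
by have := leq_add pm pm'; rewrite addSn addnS; case: (_ + _)%N.
Qed.

Lemma Pi_onX m n f : Pi m f -> Pi (m * n) (fun x => f x ^+ n).
Proof.
move=> fm; elim: n => [|n IH]; first exact: Pi_on_cst.
rewrite mulnS; apply: Pi_on_eq (Pi_onM fm IH) => x _.
by rewrite exprS.
Qed.

Lemma Pi_on_sum (I : eqType) m (s : seq I) (F : I -> T -> R) :
  (forall i, i \in s -> Pi m (F i)) -> Pi m (fun x => \sum_(i <- s) F i x).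
Proof.
elim: s => [|i s IH] Fm.
  by apply: Pi_on_eq (Pi_on_cst m 0) => x _; rewrite big_nil.
apply: Pi_on_eq (Pi_onD (Fm i (mem_head _ _)) (IH _)) => [x _|j js].
  by rewrite big_cons.
by apply: Fm; rewrite in_cons js orbT.
Qed.

Lemma Pi_on_prod (I : Type) (s : seq I) (e : I -> nat) (F : I -> T -> R) :
  (forall i, Pi (e i) (F i)) ->
  Pi (\sum_(i <- s) e i)%N (fun x => \prod_(i <- s) F i x).
Proof.
move=> Fe; elim: s => [|i s IH].
  by apply: Pi_on_eq (Pi_on_cst _ 1) => x _; rewrite big_nil.
rewrite big_cons; apply: Pi_on_eq (Pi_onM (Fe i) IH) => x _.
by rewrite big_cons.
Qed.

(** A monomial of degree at most m in coordinates of degree d has degree at most d m; linearity does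
    the rest. *)
Lemma Pi_on_comp l (U : Type) (coord' : U -> 'I_l -> R) (E : set U)
    (h : T -> U) d m f :
  (forall i, Pi d (fun x => coord' (h x) i)) -> (forall x, D x -> E (h x)) ->
  Pi_on coord' E m f -> Pi (d * m) (f \o h).
Proof.
move=> hd DE [p pm fp].
apply: (@Pi_on_eq _ (fun x => \sum_(a <- msupp p)
    mcoeff a p * \prod_i coord' (h x) i ^+ a i)).
  by move=> x /DE Eh; rewrite /= fp// mevalE.
apply: Pi_on_sum => a ap.
apply: (@Pi_onW (0 + \sum_i d * a i)%N).
  rewrite add0n -big_distrr/= -mdegE leq_mul2l -ltnS.
  by rewrite (leq_trans (msize_mdeg_lt ap) pm) orbT.
apply: Pi_onM; first exact: Pi_on_cst.
by apply: Pi_on_prod => i; exact: Pi_onX.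
Qed.

End polynomial_functions.

Section cone_disk_polynomials.
Variable R : realType.
Local Notation mR := (measurableTypeR R).

Lemma Pi_disk_Qmap m (f : R * R * R -> R) :
  Pi_cone m f -> Pi_disk (2 * m) (f \o @Qmap R).
Proof.
apply: Pi_on_comp; last by move=> z /cone_Qmap.
have u := Pi_on_coord (@coord2 R) (@disk R) ord0.
have v := Pi_on_coord (@coord2 R) (@disk R) (lift ord0 ord0).
move=> [[|[|[|//]]] i3].
- apply: Pi_on_eq (Pi_onD (Pi_onM u u) (Pi_onM (Pi_on_cst _ _ 0 (-1)) (Pi_onM v v))) => z _.
  by rewrite /Qmap/coord2/coord3/= !(tnth_nth 0)/=; ring.
- apply: Pi_on_eq (Pi_onM (Pi_on_cst _ _ 0 2) (Pi_onM u v)) => z _.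
  by rewrite /Qmap/coord2/coord3/= !(tnth_nth 0)/=; ring.
- apply: Pi_on_eq (Pi_onD (Pi_onM u u) (Pi_onM v v)) => z _.
  by rewrite /Qmap/coord2/coord3/= !(tnth_nth 0)/=; ring.
Qed.

(* u^2 = (x + t) / 2, v^2 = (t - x) / 2 and u v = y / 2 at (x, y, t) = Q(u, v). *)
Lemma monomial2_even_Qmap (a : multinom 2) : ~~ odd (mdeg a) ->
  exists2 f : R * R * R -> R, Pi_cone (mdeg a)./2 f &
    forall z, f (Qmap z) = monomial2 a z.
Proof.
set i := a ord0; set j := a (lift ord0 ord0).
have -> : mdeg a = (i + j)%N by rewrite mdegE big_ord_recl big_ord1.
rewrite oddD => ij.
(* The exponents i and j have the same parity; when both are odd, one factor u v is left beside the
   powers of u^2 and v^2. *)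
exists (fun p => ((p.1.1 + p.2) / 2) ^+ i./2 * (((p.2 - p.1.1) / 2) ^+ j./2 *
    (p.1.2 / 2) ^+ odd i)).
  have x := Pi_on_coord (@coord3 R) (@cone R) ord0.
  have y := Pi_on_coord (@coord3 R) (@cone R) 1.
  have t := Pi_on_coord (@coord3 R) (@cone R) 2.
  have h := Pi_on_cst (@coord3 R) (@cone R) 0 2^-1.
  have h' := Pi_on_cst (@coord3 R) (@cone R) 0 (-1).
  apply: (@Pi_onW _ _ _ _ _ (1 * i./2 + (1 * j./2 + 1 * odd i))%N).
    rewrite !mul1n halfD addnA addnC leq_add2r.
    by move: ij; case: (odd i) (odd j) => [] [].
  apply: Pi_onM; last apply: Pi_onM; apply: Pi_onX.
  - apply: Pi_on_eq (Pi_onM h (Pi_onD x t)) => p _.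
    by rewrite /coord3 !(tnth_nth 0)/= mulrC.
  - apply: Pi_on_eq (Pi_onM h (Pi_onD t (Pi_onM h' x))) => p _.
    by rewrite /coord3 !(tnth_nth 0)/=; ring.
  - apply: Pi_on_eq (Pi_onM h y) => p _.
    by rewrite /coord3 !(tnth_nth 0)/= mulrC.
move=> [u v]; rewrite monomial2E /Qmap/= -/i -/j.
have -> : (u ^+ 2 - v ^+ 2 + (u ^+ 2 + v ^+ 2)) / 2 = u ^+ 2 by field.
have -> : (u ^+ 2 + v ^+ 2 - (u ^+ 2 - v ^+ 2)) / 2 = v ^+ 2 by field.
have -> : 2 * u * v / 2 = u * v by field.
rewrite -[in RHS](odd_double_half i) -[in RHS](odd_double_half j).
have -> : odd j = odd i by move: ij; case: (odd i) (odd j) => [] [].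
by rewrite !exprD [(u * v) ^+ _]exprMn -!mul2n !exprM; ring.
Qed.

Lemma measurable_meval3 (p : mpoly 3 R) :
  measurable_fun setT (fun x : mR * mR * mR => meval (coord3 x) p).
Proof.
under eq_fun do rewrite mevalE.
apply: measurable_sum => a; apply: measurable_funM => //.
apply: measurable_prod => i _; apply: measurable_funX.
by case: i => [[|[|[|//]]] i3]; apply: measurableT_comp.
Qed.

(** [f] is controlled only on the cone, so it is first replaced by its polynomial, which is
    measurable everywhere. *)
Lemma disk_integral_Pi_cone (g : R) (hg : -1 < g) m (f : R * R * R -> R) :
  Pi_cone m f -> disk_integral hg (f \o @Qmap R) = cone_integral hg f.
Proof.
move=> [p _ fp]; transitivity (cone_integral hg (fun x => meval (coord3 x) p)).
  rewrite -disk_integral_Qmap; last exact: measurable_meval3.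
  by apply: eq_integral => z /[!inE] /cone_Qmap Qz; rewrite /= fp.
by apply: eq_integral => z /[!inE] cz; rewrite /= fp.
Qed.

End cone_disk_polynomials.

(** * Transfer of exactness *)

Section rule_correspondence.
Variables (R : realType) (g : R) (hg : -1 < g).

Lemma rule_sum_meval (w : rule R (R * R)%type) (p : mpoly 2 R) :
  rule_sum w (fun z => meval (coord2 z) p) =
  \sum_(a <- msupp p) mcoeff a p * rule_sum w (monomial2 a).
Proof.
rewrite /rule_sum; under [RHS]eq_bigr do rewrite mulr_sumr.
rewrite exchange_big/=; apply: eq_bigr => x _.
by rewrite mevalE mulr_sumr; apply: eq_bigr => a _; rewrite mulrCA.
Qed.

Lemma monomial2N a (z : R * R) : odd (mdeg a) ->
  monomial2 a (- z.1, - z.2) = - monomial2 a z.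
Proof.
rewrite mdegE big_ord_recl big_ord1 oddD => ij.
rewrite !monomial2E/= [in LHS]exprNn [X in _ * X]exprNn mulrACA -exprD -signr_odd.
by rewrite oddD ij mulN1r.
Qed.

(* A rule exact on the constant 1 forces the total mass to be the sum of its weights. *)
Lemma disk_measure_fin m w : cone_rules hg m w ->
  (disk_measure hg (@disk R) < +oo)%E.
Proof.
move=> [_ _ wex].
have P1 : Pi_cone m (fun=> 1 : R) by exact: Pi_on_cst.
have : disk_integral hg (fun=> 1) = (rule_sum w (fun=> 1))%:E.
  by rewrite (wex _ P1) -(disk_integral_Pi_cone hg P1).
rewrite /disk_integral (integral_cst _ _ 1%E) ?mul1e; last exact: measurable_disk.
by move=> ->; rewrite ltry.
Qed.

(** By linearity it suffices to treat monomials. Odd ones vanish on both sides; even ones of degree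
    at most 4n + 1 have degree at most 4n and factor through Q with degree at most 2n, where [w] is
    exact. *)
Lemma lift_rule_exact n (w : rule R (R * R * R)%type) z :
  cone_rules hg (2 * n) w -> preimage_choice w z ->
  symmetric_disk_rules hg (4 * n + 1) (lift_rule z w).
Proof.
move=> wP zw; have fin := disk_measure_fin wP; have [wc w0 wex] := wP.
have sym := centrally_symmetric_lift (z := z) w0.
split => //; split; [by move=> x; exact: mem_lift_rule_disk|exact: lift_rule_gt0|].
move=> f [p pm fp].
transitivity (rule_sum (lift_rule z w) (fun x => meval (coord2 x) p))%:E.
  congr EFin; apply: eq_bigr => x _; rewrite fp//.
  exact: mem_lift_rule_disk zw (valP x).
transitivity (disk_integral hg (fun x => meval (coord2 x) p)); last first.
  by apply: eq_integral => x /[!inE] dx; rewrite fp.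
rewrite rule_sum_meval disk_integral_meval// -sumEFin [LHS]big_seq [RHS]big_seq.
apply: eq_bigr => a /msize_mdeg_lt ap; rewrite EFinM; congr (_ * _)%E.
have am : (mdeg a <= 4 * n + 1)%N by rewrite -ltnS (leq_trans ap).
have [odda|/monomial2_even_Qmap evena] := boolP (odd (mdeg a)).
  rewrite disk_integral_odd//; first last.
  - by move=> x; exact: monomial2N.
  - exact: measurable_monomial2.
  - exact: integrable_monomial2.
  (* Symmetry makes the sum of an odd monomial equal to its own opposite. *)
  have : rule_sum (lift_rule z w) (monomial2 a) =
      - rule_sum (lift_rule z w) (monomial2 a).
    rewrite -{1}rule_sumN// /rule_sum -sumrN; apply: eq_bigr => x _.
    by rewrite -mulrN -monomial2N.
  by move=> h; congr EFin; lra.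
have [f' f'P f'Q] := evena R.
have f'n : Pi_cone (2 * n) f'.
  (* Halving rounds down, so 4n + 1 gives 2n: the extra degree costs nothing. *)
  apply: Pi_onW f'P; rewrite -(half_bit_double (2 * n) true).
  by rewrite half_leq// -mul2n mulnA addnC.
transitivity (rule_sum w f')%:E.
  rewrite -[in RHS](push_lift_rule w0 zw) rule_sum_push.
  by congr EFin; apply: eq_bigr => x _; rewrite /= f'Q.
rewrite (wex _ f'n) -(disk_integral_Pi_cone hg f'n).
by apply: eq_integral => x _; rewrite /= f'Q.
Qed.

(** Sum and integral both change variables along Q, and composition with the quadratic map Q doubles
    degrees, from 2n to 4n. *)
Lemma push_rule_exact n (w : rule R (R * R)%type) :
  disk_rules hg (4 * n) w -> cone_rules hg (2 * n) (push_rule w).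
Proof.
move=> [wd w0 wex]; split; last 2 first.
- exact: push_rule_gt0.
- move=> f fP; rewrite rule_sum_push -(disk_integral_Pi_cone hg fP).
  by apply: wex; have := Pi_disk_Qmap fP; rewrite mulnA.
- by move=> _ /mem_push_rule[x /wd dx ->]; apply/cone_Qmap.
Qed.

Lemma disk_rulesW m m' : (m <= m')%N -> disk_rules hg m' `<=` disk_rules hg m.
Proof.
move=> mm' w [wd w0 wex]; split => // f fm; apply: wex.
exact: Pi_onW fm.
Qed.

End rule_correspondence.

(** The [uniq] clause guarantees that the lift is the literal list of pairs, with no weights merged.
    Agreement of [L] with every preimage choice makes the lifting a well-defined map. *)
Theorem theorem4p1 (R : realType) (g : R) (hg : -1 < g) (n : nat) :
  (forall w, cone_rules hg (2 * n) w ->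
     (exists z, preimage_choice w z) /\
     forall z, preimage_choice w z ->
       uniq (unzip1 (lift_terms z w)) /\
       symmetric_disk_rules hg (4 * n + 1) (lift_rule z w)) /\
  (forall w, disk_rules hg (4 * n) w -> cone_rules hg (2 * n) (push_rule w)) /\
  [/\ forall w, cone_rules hg (2 * n) w ->
        forall z, preimage_choice w z -> push_rule (lift_rule z w) = w,
      forall w, symmetric_disk_rules hg (4 * n + 1) w ->
        forall z, preimage_choice (push_rule w) z ->
          lift_rule z (push_rule w) = w &
      exists L : rule R (R * R * R)%type -> rule R (R * R)%type,
        (forall w, cone_rules hg (2 * n) w ->
           forall z, preimage_choice w z -> L w = lift_rule z w) /\
        set_bij (cone_rules hg (2 * n))
                (symmetric_disk_rules hg (4 * n + 1)) L].
Proof.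
have pushlift w : cone_rules hg (2 * n) w ->
    forall z, preimage_choice w z -> push_rule (lift_rule z w) = w.
  by move=> [_ w0 _] z; exact: push_lift_rule.
have liftpush w : symmetric_disk_rules hg (4 * n + 1) w ->
    forall z, preimage_choice (push_rule w) z -> lift_rule z (push_rule w) = w.
  by move=> [[_ w0 _] sw] z; exact: lift_push_rule.
have push_cone w : symmetric_disk_rules hg (4 * n + 1) w ->
    cone_rules hg (2 * n) (push_rule w).
  by move=> [wd _]; apply: push_rule_exact; apply: disk_rulesW wd; rewrite leq_addr.
have choice_cone w : cone_rules hg (2 * n) w -> exists z, preimage_choice w z.
  by move=> [wc _ _]; exact: exists_preimage_choice.
split; [|split; [|split]] => //.
- move=> w wP; split; first exact: choice_cone.
  by move=> z zw; split; [exact: uniq_lift_terms|exact: lift_rule_exact].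
- by move=> w; exact: push_rule_exact.
(* A preimage choice is selected for each rule, with the zero map as default for rules that admit
   none. *)
pose L (w : rule R (R * R * R)%type) := lift_rule (xget (fun=> 0) (preimage_choice w)) w.
have Lchoice w : cone_rules hg (2 * n) w ->
    preimage_choice w (xget (fun=> 0) (preimage_choice w)).
  by move=> /choice_cone/(xgetPex (fun=> 0)).
exists L; split.
  move=> w wP z zw; apply: lift_rule_choice zw; [by case: wP|exact: Lchoice].
split.
- move=> w wP; apply: lift_rule_exact; [exact: wP|exact: Lchoice].
(* Pushing is a left inverse of [L], which gives injectivity; for surjectivity the pushed rule is
   the preimage. *)
- move=> w w' /[!inE] wP wP' LL.
  rewrite -(pushlift w wP _ (Lchoice w wP)) -(pushlift w' wP' _ (Lchoice w' wP')).
  by congr push_rule.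
- move=> w wP; exists (push_rule w); first exact: push_cone.
  by apply: liftpush => //; apply/Lchoice/push_cone.
Qed.
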